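(* Let $L$ be a frame. The following statements are equivalent. (1) Of any two ideals in $\mathcal{R}L$ whose sum is a proper $z$-ideal, at least one is a $z$-ideal. (2) $L$ is a $P_F$-frame. (3) Of any two ideals in $\mathcal{R}L$ whose intersection is a $z$-ideal, at least one is a $z$-ideal.
   Context: A frame is a complete lattice $L$ (top $1$, bottom $0$) satisfying $a\wedge\bigvee S=\bigvee\{a\wedge s\mid s\in S\}$ for all $a\in L$, $S\subseteq L$. Throughout, all frames are assumed completely regular: $a=\bigvee\{x\mid x\prec\!\prec a\}$ for all $a$, where $a\prec b$ means there is $t$ with $a\wedge t=0$, $t\vee b=1$, and $a\prec\!\prec b$ means there is a family $(c_q)_{q\in\mathbb{Q}\cap[0,1]}$ with $c_0=a$, $c_1=b$, $c_r\prec c_s$ for $r<s$. An element $a$ is complemented if $a\vee a^*=1$, where $a^*=\bigvee\{x\in L\mid x\wedge a=0\}$. $\mathcal{L}(\mathbb{R})$ is the frame of reals, generated by pairs $(p,q)$ of rationals subject to $(p,q)\wedge(r,s)=(p\vee r,q\wedge s)$; $(p,q)\vee(r,s)=(p,s)$ when $p\le r<q\le s$; $(p,q)=\bigvee\{(r,s)\mid p<r<s<q\}$; $1=\bigvee\{(p,q)\mid p,q\in\mathbb{Q}\}$. $\mathcal{R}L$ is the ring of real-valued continuous functions on $L$: the set of frame homomorphisms $\mathcal{L}(\mathbb{R})\to L$, a commutative ring with identity under $(\varphi\diamond\psi)(p,q)=\bigvee\{\varphi(r,s)\wedge\psi(t,u)\mid x\diamond y\in(p,q)\text{ for all rationals }x\in(r,s),\,y\in(t,u)\}$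 for $\diamond\in\{+,\cdot\}$. For $\varphi\in\mathcal{R}L$, $\mathrm{coz}\,\varphi=\bigvee\{\varphi(p,0)\vee\varphi(0,q)\mid p,q\in\mathbb{Q}\}$, and $\mathrm{Coz}\,L=\{\mathrm{coz}\,\varphi\mid\varphi\in\mathcal{R}L\}$. $L$ is a $P_F$-frame if whenever $a,b\in\mathrm{Coz}\,L$ satisfy $a\wedge b=0$, at least one of $a,b$ is complemented. An ideal $I$ of $\mathcal{R}L$ is a $z$-ideal if for any $\alpha\in\mathcal{R}L$ and $\varphi\in I$, $\mathrm{coz}\,\alpha=\mathrm{coz}\,\varphi$ implies $\alpha\in I$. *)

(* Defs.v *)
From HB Require Import structures.
From mathcomp Require Import all_boot all_order all_algebra.
From mathcomp Require Import boolp classical_sets.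
From mathcomp Require Import ring lra.

Set Implicit Arguments.
Unset Strict Implicit.
Unset Printing Implicit Defensive.

Import Order.TTheory GRing.Theory Num.Theory.
Local Open Scope ring_scope.
Local Open Scope order_scope.

Reserved Notation "\fsup S" (at level 10, S at level 9, format "\fsup  S").

HB.mixin Record isFrame d L of Order.TBLattice d L := {
  fsup : set L -> L;
  fsup_ub : forall (S : set L) (a : L), S a -> a <= fsup S;
  fsup_le : forall (S : set L) (b : L),
    (forall a, S a -> a <= b) -> fsup S <= b;
  meet_fsup : forall (a : L) (S : set L),
    a `&` fsup S = fsup [set (a `&` s)%O | s in S]%classic
}.

#[short(type="frameType")]
HB.structure Definition Frame d := { L of isFrame d L & Order.TBLattice d L }.

Arguments fsup_ub {d s} [S a].
Arguments fsup_le {d s} [S b].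

Notation "\fsup S" := (fsup S) : order_scope.

Section FrameTheory.
Context d (L : frameType d).
Implicit Types (a b x y : L) (S T : set L).

Lemma fsup_sub S T : (forall a, S a -> exists2 b, T b & a <= b) ->
  \fsup S <= \fsup T.
Proof.
by move=> h; apply: fsup_le => a /h [b Tb ab]; apply: le_trans ab (fsup_ub Tb).
Qed.

Lemma meet_fsup_le S x y :
  (forall s, S s -> x `&` s <= y) -> x `&` \fsup S <= y.
Proof. by move=> h; rewrite meet_fsup; apply: fsup_le => _ [s Ss <-]; apply: h. Qed.

Lemma cover_le S x y : x <= \fsup S -> (forall s, S s -> x `&` s <= y) -> x <= y.
Proof. by move=> xS h; rewrite -(meet_l xS); apply: meet_fsup_le. Qed.

Lemma frame_meetUr x y z : z `&` (x `|` y) = (z `&` x) `|` (z `&` y).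
Proof.
apply/le_anti; rewrite [X in _ && X]leUx !leI2 ?leUl ?leUr // !andbT.
suff -> : x `|` y = \fsup [set x; y]%classic.
  by apply: meet_fsup_le => s [] ->; rewrite ?leUl ?leUr.
apply/le_anti; rewrite leUx !fsup_ub /=; [|by right|by left].
by apply: fsup_le => s [] ->; rewrite ?leUl ?leUr.
Qed.

Lemma frame_meetUl x y z : (x `|` y) `&` z = (x `&` z) `|` (y `&` z).
Proof. by rewrite meetC frame_meetUr ![z `&` _]meetC. Qed.

End FrameTheory.

Section Complements.
Context d (L : frameType d).
Implicit Types a b : L.

Definition pcomplement a : L := \fsup [set x | (x `&` a)%O = \bot]%classic.

Definition complemented a : Prop := a `|` pcomplement a = \top.

Definition rather_below a b : Prop :=
  exists t : L, a `&` t = \bot /\ t `|` b = \top.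

Definition completely_below a b : Prop :=
  exists c : rat -> L, [/\ c 0 = a, c 1 = b &
    forall r s : rat, 0 <= r -> r < s -> s <= 1 -> rather_below (c r) (c s)].

End Complements.

Definition completely_regular d (L : frameType d) : Prop :=
  forall a : L, a = \fsup [set x | completely_below x a]%classic.

Record frame_hom d d' (L : frameType d) (M : frameType d') := FrameHom {
  frame_hom_fun :> L -> M;
  frame_homT : frame_hom_fun \top = \top;
  frame_homI : forall a b,
    frame_hom_fun (a `&` b) = frame_hom_fun a `&` frame_hom_fun b;
  frame_hom_fsup : forall S : set L,
    frame_hom_fun (\fsup S) = \fsup [set frame_hom_fun s | s in S]%classic
}.

Lemma frame_hom_eq d d' (L : frameType d) (M : frameType d')
  (h k : frame_hom L M) : h =1 k -> h = k.
Proof.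
case: h k => [h h1 h2 h3] [k k1 k2 k3] /= /funext hk.
by rewrite hk in h1 h2 h3 *; congr FrameHom; apply: Prop_irrelevance.
Qed.

Lemma frame_hom_le d d' (L : frameType d) (M : frameType d')
  (h : frame_hom L M) a b : a <= b -> h a <= h b.
Proof. by move=> /meet_idPl ab; rewrite -ab frame_homI leIr. Qed.

(* The defining relations of the frame of reals, for a family [f p q] that
   interprets the generators [(p, q)] in a frame. *)
Record real_relations d (L : frameType d) (f : rat -> rat -> L) : Prop := {
  rel_meet : forall p q r s : rat,
    f p q `&` f r s = f (Num.max p r) (Num.min q s);
  rel_join : forall p q r s : rat, p <= r -> r < q -> q <= s ->
    f p q `|` f r s = f p s;
  rel_sup : forall p q : rat,
    f p q = \fsup [set x | exists r s, [/\ p < r, r < s, s < q & x = f r s]]%classic;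
  rel_top : \top = \fsup [set x | exists p q, x = f p q]%classic
}.

(* The frame presented by these generators and relations is built as the
   lattice of sets of generators that are down-closed (for the order of the
   meet-semilattice of generators) and closed under the two covering relations
   [rel_join] and [rel_sup].
   [reals_relations] and [reals_universal] below state that it is the frame
   presented by the generators and relations. *)
Record real_ideal (U : set (rat * rat)) : Prop := {
  real_ideal_down : forall p q r s : rat,
    U (p, q) -> p <= r -> s <= q -> U (r, s);
  real_ideal_join : forall p q r s : rat, p <= r -> r < q -> q <= s ->
    U (p, q) -> U (r, s) -> U (p, s);
  real_ideal_sup : forall p q : rat,
    (forall r s, p < r -> r < s -> s < q -> U (r, s)) -> U (p, q)
}.

Record reals := Reals {
  reals_set :> rat * rat -> Prop;
  reals_ideal : real_ideal reals_set
}.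

HB.instance Definition _ := gen_eqMixin reals.
HB.instance Definition _ := gen_choiceMixin reals.

Fact reals_display : Order.disp_t. Proof. exact: Order.Disp tt tt. Qed.

Section RealsFrame.
Implicit Types U V W : reals.

Lemma reals_eq U V : (forall x, U x <-> V x) -> U = V.
Proof.
case: U V => [U hU] [V hV] /= UV.
have E : U = V by apply: funext => x; apply: propext.
by rewrite E in hU *; congr Reals; apply: Prop_irrelevance.
Qed.

Definition reals_le U V : bool := `[< reals_set U `<=` reals_set V >]%classic.

Fact reals_le_refl : reflexive reals_le.
Proof. by move=> U; apply/asboolP. Qed.
Fact reals_le_anti : antisymmetric reals_le.
Proof.
move=> U V /andP [/asboolP UV /asboolP VU].
by apply: reals_eq => x; split; [apply: UV | apply: VU].
Qed.
Fact reals_le_trans : transitive reals_le.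
Proof.
by move=> V U W /asboolP UV /asboolP VW; apply/asboolP => x /UV /VW.
Qed.

HB.instance Definition _ := Order.Le_isPOrder.Build reals_display reals
  reals_le_refl reals_le_anti reals_le_trans.

Lemma reals_leP U V : reflect (forall p q, U (p, q) -> V (p, q)) (U <= V).
Proof.
by apply: (iffP (asboolP _)) => [UV p q /UV //|UV [p q] /UV].
Qed.

Fact real_ideal_bigcap (C : set (set (rat * rat))) :
  (forall A, C A -> real_ideal A) ->
  real_ideal [set x | forall A, C A -> A x]%classic.
Proof.
move=> hC; split=> /=.
- move=> p q r s h pr sq U CU.
  exact: (real_ideal_down (hC _ CU) (h _ CU)).
- move=> p q r s pr rq qs h1 h2 U CU.
  exact: (real_ideal_join (hC _ CU) pr rq qs (h1 _ CU) (h2 _ CU)).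
- move=> p q h U CU; apply: (real_ideal_sup (hC _ CU)) => r s pr rs sq.
  exact: h.
Qed.

Definition reals_generated (A : set (rat * rat)) : reals :=
  Reals (@real_ideal_bigcap [set B | real_ideal B /\ A `<=` B]%classic
           (fun B h => proj1 h)).

Lemma sub_reals_generated (A : set (rat * rat)) x : A x -> reals_generated A x.
Proof. by move=> Ax B [_ AB]; apply: AB. Qed.

Lemma reals_generated_min (A : set (rat * rat)) (U : set (rat * rat)) :
  real_ideal U -> (A `<=` U)%classic -> forall x, reals_generated A x -> U x.
Proof. by move=> hU AU x h; apply: (h U (conj hU AU)). Qed.

Fact real_ideal_setI U V : real_ideal (reals_set U `&` reals_set V)%classic.
Proof.
split=> /=.
- move=> p q r s [h1 h2] pr sq.
  by split; [apply: (real_ideal_down (reals_ideal U) h1) |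
             apply: (real_ideal_down (reals_ideal V) h2)].
- move=> p q r s pr rq qs [h1 h2] [h3 h4].
  by split; [apply: (real_ideal_join (reals_ideal U) pr rq qs) |
             apply: (real_ideal_join (reals_ideal V) pr rq qs)].
- move=> p q h; split.
    by apply: (real_ideal_sup (reals_ideal U)) => r s pr rs sq; case: (h r s pr rs sq).
  by apply: (real_ideal_sup (reals_ideal V)) => r s pr rs sq; case: (h r s pr rs sq).
Qed.

Fact real_ideal_setT : real_ideal setT.
Proof. by []. Qed.

Definition reals_meet U V : reals := Reals (real_ideal_setI U V).
Definition reals_join U V : reals := reals_generated (reals_set U `|` reals_set V)%classic.
Definition reals_top : reals := Reals real_ideal_setT.
Definition reals_bot : reals := reals_generated set0.
Definition reals_sup (S : set reals) : reals :=
  reals_generated [set x | exists2 U : reals, S U & U x]%classic.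

Lemma reals_joinP U V W : (reals_join U V <= W) = (U <= W) && (V <= W).
Proof.
apply/idP/andP => [/reals_leP h|[/reals_leP h1 /reals_leP h2]].
  by split; apply/reals_leP => p q Ux; apply: h;
    apply: sub_reals_generated; [left|right].
apply/reals_leP => p q; apply: (reals_generated_min (reals_ideal W)).
by move=> [x y] [/h1|/h2].
Qed.

Fact reals_meetC : commutative reals_meet.
Proof. by move=> U V; apply: reals_eq => x; split=> -[]. Qed.
Fact reals_meetA : associative reals_meet.
Proof.
by move=> U V W; apply: reals_eq => x; split=> [[? []]|[[]]].
Qed.
Fact reals_joinC : commutative reals_join.
Proof.
by move=> U V; congr reals_generated; rewrite classical_sets.setUC.
Qed.
Fact reals_joinA : associative reals_join.
Proof.
move=> U V W; have := lexx (reals_join (reals_join U V) W).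
have := lexx (reals_join U (reals_join V W)).
rewrite !reals_joinP => /and3P[h1 h2 h3] /andP[/andP[h4 h5] h6].
by apply/le_anti; rewrite !reals_joinP h1 h2 h3 h4 h5 h6.
Qed.
Fact reals_joinKI V U : reals_meet U (reals_join U V) = U.
Proof.
apply: reals_eq => x; split=> [[]//|Ux]; split=> //.
by apply: sub_reals_generated => /=; left.
Qed.
Fact reals_meetKU V U : reals_join U (reals_meet U V) = U.
Proof.
have := lexx (reals_join U (reals_meet U V)); rewrite reals_joinP => /andP[h _].
apply/le_anti; rewrite h andbT reals_joinP lexx /=.
by apply/reals_leP => p q [].
Qed.
Fact reals_leEmeet U V : (U <= V) = (reals_meet U V == U).
Proof.
apply/reals_leP/eqP => [UV|<- p q [] //].
by apply: reals_eq => -[p q]; split=> [[] //|Ux]; split=> //; apply: UV.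
Qed.

HB.instance Definition _ := Order.POrder_isLattice.Build reals_display reals
  reals_meetC reals_joinC reals_meetA reals_joinA reals_joinKI reals_meetKU
  reals_leEmeet.

Fact reals_le0 U : reals_bot <= U.
Proof.
apply/reals_leP => p q; apply: (reals_generated_min (reals_ideal U)).
by move=> ?.
Qed.
Fact reals_lex1 U : U <= reals_top.
Proof. by apply/reals_leP. Qed.

HB.instance Definition _ :=
  Order.hasBottom.Build reals_display reals reals_le0.
HB.instance Definition _ := Order.hasTop.Build reals_display reals reals_lex1.

Fact reals_sup_ub (S : set reals) U : S U -> U <= reals_sup S.
Proof.
by move=> SU; apply/reals_leP => p q Ux; apply: sub_reals_generated; exists U.
Qed.

Fact reals_sup_le (S : set reals) V :
  (forall U, S U -> U <= V) -> reals_sup S <= V.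
Proof.
move=> h; apply/reals_leP => p q.
apply: (reals_generated_min (reals_ideal V)) => -[r s] [U SU].
exact/reals_leP/h.
Qed.

Lemma real_ideal_degenerate (U : set (rat * rat)) p q :
  real_ideal U -> q <= p -> U (p, q).
Proof. by move=> hU qp; apply: (real_ideal_sup hU) => r s *; lra. Qed.

(* Heyting implication between ideals. *)
Fact real_ideal_imp (U V : reals) :
  real_ideal [set x | forall p q, U (p, q) -> x.1 <= p -> q <= x.2 -> V (p, q)]%classic.
Proof.
have hU := reals_ideal U; have hV := reals_ideal V.
split=> /=.
- move=> p q r s h pr sq a b Uab ra bs.
  by apply: h => //; [exact: le_trans ra | exact: le_trans sq].
- move=> p q r s pr rq qs h1 h2 a b Uab pa bs.
  have [ra|ar] := leP r a; first exact: h2.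
  have [bq|qb] := leP b q; first exact: h1.
  apply: (real_ideal_join hV (p := a) (q := q) (r := r)) => //; rewrite ?ltW //.
    by apply: h1 => //; apply: (real_ideal_down hU Uab) => //; exact: ltW.
  by apply: h2 => //; apply: (real_ideal_down hU Uab) => //; exact: ltW.
- move=> p q h a b Uab pa bq; apply: (real_ideal_sup hV) => r s ar rs sb.
  apply: (h r s) => //; first exact: le_lt_trans ar.
    exact: lt_le_trans bq.
  by apply: (real_ideal_down hU Uab); exact: ltW.
Qed.

Fact reals_meet_sup U (S : set reals) :
  U `&` reals_sup S = reals_sup [set (U `&` V)%O | V in S]%classic.
Proof.
apply/le_anti/andP; split; last first.
  by apply: reals_sup_le => _ [V SV <-]; apply: leI2 => //; apply: reals_sup_ub.
apply/reals_leP => p q [Ux Sx].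
pose R := reals_sup [set (U `&` V)%O | V in S]%classic.
suff key : forall x, reals_sup S x -> forall a b, U (a, b) ->
    x.1 <= a -> b <= x.2 -> R (a, b) by exact: key Sx _ _ Ux (lexx _) (lexx _).
apply: (reals_generated_min (real_ideal_imp U R)).
move=> [a b] [V SV Vab] r s Urs ar sb.
apply: sub_reals_generated; exists (U `&` V); first by exists V.
by split=> //; apply: (real_ideal_down (reals_ideal V) Vab).
Qed.

HB.instance Definition _ := isFrame.Build reals_display reals
  reals_sup_ub reals_sup_le reals_meet_sup.

Fact real_ideal_gen (p q : rat) :
  real_ideal [set x | x.2 <= x.1 \/ p <= x.1 /\ x.2 <= q]%classic.
Proof.
split=> /=.
- move=> a b r s [ba|[pa bq]] ar sb; [left|right]; first lra.
  by split; lra.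
- move=> a b r s ar rb bs [h1|[h1 h2]] [h3|[h3 h4]]; first [right; split; lra | lra].
- move=> a b h; have [ba|ab] := leP b a; [by left | right; split].
    rewrite leNgt; apply/negP => ap; pose m := Num.min p b.
    have am : a < m by rewrite lt_min ap ab.
    have [mp mb] : m <= p /\ m <= b by split; rewrite ge_min lexx ?orbT.
    by have [] : _ \/ _ := h (a + (m - a) / 3) (a + (m - a) / 2) _ _ _; lra.
  rewrite leNgt; apply/negP => qb; pose m := Num.max q a.
  have am : m < b by rewrite gt_max ab qb.
  have [mp mb] : q <= m /\ a <= m by split; rewrite le_max lexx ?orbT.
  by have [] : _ \/ _ := h (b - (b - m) / 2) (b - (b - m) / 3) _ _ _; lra.
Qed.

Definition reals_gen (p q : rat) : reals := Reals (real_ideal_gen p q).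

Lemma reals_genP p q U : reflect (U (p, q)) (reals_gen p q <= U).
Proof.
apply: (iffP idP) => [/reals_leP h|Upq]; first by apply: h; right.
apply/reals_leP => r s /= [sr|[pr sq]].
  exact: (real_ideal_degenerate (reals_ideal U)).
exact: (real_ideal_down (reals_ideal U) Upq).
Qed.

Lemma reals_gen_sup U : U = \fsup [set x | exists p q, U (p, q) /\ x = reals_gen p q]%classic.
Proof.
apply/le_anti/andP; split.
  apply/reals_leP => p q Upq.
  apply/reals_genP; apply: fsup_ub; by exists p, q.
by apply: fsup_le => _ [p [q [Upq ->]]]; apply/reals_genP.
Qed.

Lemma reals_relations : real_relations reals_gen.
Proof.
split.
- move=> p q r s; apply: reals_eq => -[a b] /=.
  rewrite ge_max le_min; split=> [[[h|[h1 h2]] [h'|[h3 h4]]]|[h|[/andP[h1 h2] /andP[h3 h4]]]].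
  + by left.
  + by left.
  + by left.
  + by right; rewrite h1 h2 h3 h4.
  + by split; left.
  + by split; right.
- move=> p q r s pr rq qs; apply/le_anti; rewrite leUx -andbA; apply/and3P; split.
  + by apply/reals_genP; right.
  + by apply/reals_genP; right.
  + set W := _ `|` _; apply/reals_genP.
    apply: (real_ideal_join (reals_ideal W) pr rq qs); apply/reals_genP.
      exact: leUl.
    exact: leUr.
- move=> p q; apply/le_anti/andP; split.
    apply/reals_genP; apply: real_ideal_sup; first exact: reals_ideal.
    by move=> r s pr rs sq; apply/reals_genP/fsup_ub; exists r, s.
  apply: fsup_le => _ [r [s [pr rs sq ->]]].
  by apply/reals_genP; right; split; apply: ltW.
- apply/le_anti; rewrite lex1 andbT; apply/reals_leP => p q _.
  by apply/reals_genP/fsup_ub; exists p, q.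
Qed.

End RealsFrame.

Section RealRelationsTheory.
Context d (L : frameType d) (f : rat -> rat -> L) (hf : real_relations f).

Lemma rel_le (p q r s : rat) : r <= p -> q <= s -> f p q <= f r s.
Proof.
move=> rp qs; rewrite leEmeet (rel_meet hf).
by rewrite (max_idPl rp) (min_idPl qs).
Qed.

Lemma rel_bot (p q : rat) : q <= p -> f p q = \bot.
Proof.
move=> qp; apply/le_anti; rewrite le0x andbT (rel_sup hf).
by apply: fsup_le => x [r [s [pr rs sq _]]]; exfalso; lra.
Qed.

Lemma real_ideal_rel (a : L) : real_ideal [set x | f x.1 x.2 <= a]%classic.
Proof.
split=> /=.
- by move=> p q r s h pr sq; apply: le_trans h; apply: rel_le.
- by move=> p q r s pr rq qs h1 h2; rewrite -(rel_join hf pr rq qs) leUx h1.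
- move=> p q h; rewrite (rel_sup hf).
  by apply: fsup_le => _ [r [s [pr rs sq ->]]]; apply: h.
Qed.

Definition reals_ext (U : reals) : L :=
  \fsup [set x | exists p q, U (p, q) /\ x = f p q]%classic.

Lemma reals_ext_gen p q : reals_ext (reals_gen p q) = f p q.
Proof.
apply/le_anti/andP; split; last by apply: fsup_ub; exists p, q; split=> //; right.
apply: fsup_le => _ [r [s [[/= sr|[/= pr sq]] ->]]].
  by rewrite rel_bot ?le0x.
exact: rel_le.
Qed.

Fact reals_extT : reals_ext \top = \top.
Proof.
apply/le_anti; rewrite lex1 /= (rel_top hf).
by apply: fsup_le => _ [p [q ->]]; apply: fsup_ub; exists p, q.
Qed.

Fact reals_extI U V : reals_ext (U `&` V) = reals_ext U `&` reals_ext V.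
Proof.
apply/le_anti/andP; split.
  rewrite lexI; apply/andP; split; apply: fsup_le => _ [p [q [[Up Vp] ->]]];
    by apply: fsup_ub; exists p, q.
apply: meet_fsup_le => _ [p [q [Vpq ->]]]; rewrite meetC.
apply: meet_fsup_le => _ [r [s [Urs ->]]].
rewrite (rel_meet hf); apply: fsup_ub; exists (Num.max p r), (Num.min q s).
split=> //; split.
  by apply: (real_ideal_down (reals_ideal U) Urs); rewrite ?le_max ?ge_min lexx ?orbT.
by apply: (real_ideal_down (reals_ideal V) Vpq); rewrite ?le_max ?ge_min lexx ?orbT.
Qed.

Fact reals_ext_sup (S : set reals) :
  reals_ext (\fsup S) = \fsup [set reals_ext s | s in S]%classic.
Proof.
apply/le_anti/andP; split; last first.
  apply: fsup_le => _ [U SU <-]; apply: fsup_sub => _ [p [q [Upq ->]]].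
  exists (f p q) => //; exists p, q; split=> //.
  by move: p q Upq; apply/reals_leP/fsup_ub.
apply: fsup_le => _ [p [q [Upq ->]]].
apply: (reals_generated_min (real_ideal_rel _) _ Upq) => -[r s] [U SU Urs] /=.
apply: (@le_trans _ _ (reals_ext U)); last by apply: fsup_ub; exists U.
by apply: fsup_ub; exists r, s.
Qed.

Definition reals_hom : frame_hom reals L :=
  FrameHom reals_extT reals_extI reals_ext_sup.

End RealRelationsTheory.

Lemma frame_hom_relations d (L : frameType d) (h : frame_hom reals L) :
  real_relations (fun p q => h (reals_gen p q)).
Proof.
have hg := reals_relations; split.
- by move=> p q r s; rewrite -frame_homI (rel_meet hg).
- move=> p q r s pr rq qs; apply/le_anti/andP; split.
    by rewrite leUx !frame_hom_le ?rel_le.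
  have -> : reals_gen p s =
      \fsup [set reals_gen p q; reals_gen r s]%classic.
    rewrite -(rel_join hg pr rq qs); apply/le_anti; rewrite leUx !fsup_ub /=;
      [|by right|by left].
    by apply: fsup_le => _ [] ->; rewrite ?leUl ?leUr.
  by rewrite frame_hom_fsup; apply: fsup_le => _ [_ [] -> <-]; rewrite ?leUl ?leUr.
- move=> p q; rewrite [in LHS](rel_sup hg) frame_hom_fsup; congr fsup.
  apply/seteqP; split=> x /=.
    by move=> [_ [r [s [pr rs sq ->]]] <-]; exists r, s.
  by move=> [r [s [pr rs sq ->]]]; exists (reals_gen r s) => //; exists r, s.
- rewrite -(frame_homT h) (rel_top hg) frame_hom_fsup; congr fsup.
  apply/seteqP; split=> x /=; first by move=> [_ [p [q ->]] <-]; exists p, q.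
  by move=> [p [q ->]]; exists (reals_gen p q) => //; exists p, q.
Qed.

Lemma reals_hom_eq d (L : frameType d) (h k : frame_hom reals L) :
  (forall p q, h (reals_gen p q) = k (reals_gen p q)) -> h = k.
Proof.
move=> hk; apply: frame_hom_eq => U; rewrite (reals_gen_sup U) !frame_hom_fsup.
congr fsup; apply/seteqP; split=> x /=.
  by move=> [_ [p [q [Upq ->]]] <-]; exists (reals_gen p q); [exists p, q|].
by move=> [_ [p [q [Upq ->]]] <-]; exists (reals_gen p q); [exists p, q|].
Qed.

Lemma reals_universal d (L : frameType d) (f : rat -> rat -> L) :
  real_relations f ->
  exists! h : frame_hom reals L, forall p q, h (reals_gen p q) = f p q.
Proof.
move=> hf; exists (reals_hom hf); split; first exact: reals_ext_gen.
by move=> k hk; apply: reals_hom_eq => p q; rewrite hk; apply: reals_ext_gen.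
Qed.

Definition RL d (L : frameType d) := frame_hom reals L.

(* The value [phi (p, q)] of a real-valued function at a generator. *)
Definition rval d (L : frameType d) (phi : RL L) (p q : rat) : L :=
  phi (reals_gen p q).

Section RvalTheory.
Context d (L : frameType d).
Implicit Types (phi psi chi : RL L) (x y : L) (p q r s e c N : rat).

Lemma rvalI phi p q r s :
  rval phi p q `&` rval phi r s = rval phi (Num.max p r) (Num.min q s).
Proof. exact: (rel_meet (frame_hom_relations phi)). Qed.

Lemma rval_le phi p q r s : r <= p -> q <= s -> rval phi p q <= rval phi r s.
Proof. exact: (rel_le (frame_hom_relations phi)). Qed.

Lemma rval_bot phi p q : q <= p -> rval phi p q = \bot.
Proof. exact: (rel_bot (frame_hom_relations phi)). Qed.

Lemma rval_eq phi psi :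
  (forall p q, rval phi p q = rval psi p q) -> phi = psi.
Proof. exact: reals_hom_eq. Qed.

Lemma rval_inner phi p q x y :
  (forall r s, p < r -> r < s -> s < q -> x `&` rval phi r s <= y) ->
  x `&` rval phi p q <= y.
Proof.
move=> h; rewrite /rval (rel_sup (frame_hom_relations phi)).
by apply: meet_fsup_le => _ [r [s [pr rs sq ->]]]; apply: h.
Qed.

Lemma rval_cover phi x y : (forall p q, x `&` rval phi p q <= y) -> x <= y.
Proof.
move=> h; rewrite -(meetx1 x) (rel_top (frame_hom_relations phi)).
by apply: meet_fsup_le => _ [p [q ->]]; apply: h.
Qed.

Lemma rval_bounded phi x y :
  (forall N, 0 < N -> x `&` rval phi (- N) N <= y) -> x <= y.
Proof.
move=> h; apply: (rval_cover (phi := phi)) => p q.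
have [p1 p2] : - `|p| <= p /\ p <= `|p| by split; [exact: lerNnormlW | exact: ler_norm].
have [q1 q2] : - `|q| <= q /\ q <= `|q| by split; [exact: lerNnormlW | exact: ler_norm].
have := normr_ge0 p; have := normr_ge0 q => q0 p0.
apply: le_trans (h (`|p| + `|q| + 1) _); last lra.
by apply: leI2 => //; apply: rval_le; lra.
Qed.

Lemma rval_small phi e x y : 0 < e ->
  (forall c, x `&` rval phi (c - e) (c + e) <= y) -> x <= y.
Proof.
move=> e0 h; apply: (rval_cover (phi := phi)) => p q.
have [n] : exists n : nat, q - p <= e * n%:R.
  exists (Num.bound (`|q - p| / e)).
  have := archi_boundP (divr_ge0 (normr_ge0 (q - p)) (ltW e0)).
  rewrite ltr_pdivrMr // mulrC => hn.
  by apply: le_trans (ltW hn); apply: ler_norm.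
elim: n p q => [|n IHn] p q pq.
  by rewrite rval_bot ?meetx0 ?le0x //; lra.
rewrite -natr1 mulrDr mulr1 in pq.
have [big|small] := leP (p + e + e) q.
  have <- : rval phi p (p + e + e) `|` rval phi (p + e) q = rval phi p q.
    by apply: (rel_join (frame_hom_relations phi)); lra.
  rewrite frame_meetUr leUx (IHn (p + e) q) ?andbT; last lra.
  apply: le_trans (h (p + e)); apply: leI2 => //; apply: rval_le; lra.
apply: le_trans (h (p + e)); apply: leI2 => //; apply: rval_le; lra.
Qed.

(* Two functions that are locally arbitrarily close to each other are equal. *)
Lemma rval_close_le phi psi :
  (forall e, 0 < e -> forall x y,
    (forall c, x `&` (rval phi (c - e) (c + e) `&` rval psi (c - e) (c + e)) <= y) ->
    x <= y) ->
  forall p q, rval phi p q <= rval psi p q.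
Proof.
move=> h p q; rewrite -[leLHS]meet1x.
apply: rval_inner => r s pr rs sq; rewrite meet1x.
pose e := Num.min (r - p) (q - s) / 2.
have [e1 e2] : e <= (r - p) / 2 /\ e <= (q - s) / 2.
  by rewrite /e; case: (leP (r - p) (q - s)) => ?; split; lra.
have e0 : 0 < e by rewrite /e; case: (leP (r - p) (q - s)) => ?; lra.
apply: (h e e0) => c; rewrite meetA rvalI.
have [deg|] := leP (Num.min s (c + e)) (Num.max r (c - e)).
  by rewrite rval_bot // meet0x le0x.
rewrite gt_max !lt_min => /andP[/andP[_ h1] /andP[h2 _]].
by apply: le_trans (leIr _ _) _; apply: rval_le; lra.
Qed.

Lemma rval_close_eq phi psi :
  (forall e, 0 < e -> forall x y,
    (forall c, x `&` (rval phi (c - e) (c + e) `&` rval psi (c - e) (c + e)) <= y) ->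
    x <= y) ->
  phi = psi.
Proof.
move=> h; apply: rval_eq => p q; apply/le_anti.
rewrite !rval_close_le // => e e0 x y hc; apply: (h e e0) => c.
by rewrite [X in _ `&` X <= _]meetC; apply: hc.
Qed.

End RvalTheory.

(* What is needed of an operation on the rationals for it to induce an
   operation on real-valued functions. *)
Record tame_op (f : rat -> rat -> rat) : Prop := {
  tame_extrema : forall r s t u : rat, r <= s -> t <= u ->
    exists x1 y1 x2 y2 : rat,
    [/\ r <= x1 <= s /\ t <= y1 <= u, r <= x2 <= s /\ t <= y2 <= u &
      forall x y : rat, r <= x <= s -> t <= y <= u ->
        f x1 y1 <= f x y <= f x2 y2];
  tame_continuous : forall N e : rat, 0 < e -> exists2 e' : rat, 0 < e' &
    forall x x' y y' : rat,
    `|x| <= N -> `|x'| <= N -> `|y| <= N -> `|y'| <= N ->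
    `|x - x'| < e' -> `|y - y'| < e' -> `|f x y - f x' y'| < e
}.

Lemma tame_add : tame_op +%R.
Proof.
split=> [r s t u rs tu|N e e0].
  by exists r, t, s, u; split; [lra|lra|move=> x y *; lra].
exists (e / 2); first lra.
by move=> x x' y y' _ _ _ _; rewrite !ltr_norml => ? ?; lra.
Qed.

Lemma max4 (a b c e : rat) : exists m,
  [\/ m = a, m = b, m = c | m = e] /\ [/\ a <= m, b <= m, c <= m & e <= m].
Proof.
exists (Num.max (Num.max a b) (Num.max c e)); rewrite !le_max !lexx ?orbT; split=> //.
have maxE (x y : rat) : Num.max x y = x \/ Num.max x y = y.
  by case: (leP x y); [right|left].
case: (maxE a b) (maxE c e) (maxE (Num.max a b) (Num.max c e)) => -> [] -> [] ->;
  first [by constructor 1|by constructor 2|by constructor 3|by constructor 4].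
Qed.

Lemma min4 (a b c e : rat) : exists m,
  [\/ m = a, m = b, m = c | m = e] /\ [/\ m <= a, m <= b, m <= c & m <= e].
Proof.
have [m [h [h1 h2 h3 h4]]] := max4 (- a) (- b) (- c) (- e).
exists (- m); split; last by split; rewrite lerNl.
by case: h => ->; rewrite opprK;
  [constructor 1|constructor 2|constructor 3|constructor 4].
Qed.

Lemma tame_mul : tame_op *%R.
Proof.
split=> [r s t u rs tu|N e e0].
- have lin x y c : r <= x -> x <= s -> t <= y -> y <= u ->
      r * t <= c -> r * u <= c -> s * t <= c -> s * u <= c -> x * y <= c.
    move=> rx xs ty yu h1 h2 h3 h4.
    have hr : r * y <= c.
      have [r0|r0] := leP 0 r; first by apply: le_trans h2; nra.
      by apply: le_trans h1; nra.
    have hs : s * y <= c.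
      have [s0|s0] := leP 0 s; first by apply: le_trans h4; nra.
      by apply: le_trans h3; nra.
    have [y0|y0] := leP 0 y; first by apply: le_trans hs; nra.
    by apply: le_trans hr; nra.
  have linl x y c : r <= x -> x <= s -> t <= y -> y <= u ->
      c <= r * t -> c <= r * u -> c <= s * t -> c <= s * u -> c <= x * y.
    move=> rx xs ty yu h1 h2 h3 h4.
    have hr : c <= r * y.
      have [r0|r0] := leP 0 r; first by apply: le_trans h1 _; nra.
      by apply: le_trans h2 _; nra.
    have hs : c <= s * y.
      have [s0|s0] := leP 0 s; first by apply: le_trans h3 _; nra.
      by apply: le_trans h4 _; nra.
    have [y0|y0] := leP 0 y; first by apply: le_trans hr _; nra.
    by apply: le_trans hs _; nra.
  have [m [hm [m1 m2 m3 m4]]] := max4 (r * t) (r * u) (s * t) (s * u).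
  have [k [hk [k1 k2 k3 k4]]] := min4 (r * t) (r * u) (s * t) (s * u).
  have corner c : [\/ c = r * t, c = r * u, c = s * t | c = s * u] ->
      exists x y, [/\ r <= x <= s, t <= y <= u & c = x * y].
    by case=> ->; [exists r, t|exists r, u|exists s, t|exists s, u]; rewrite !lexx rs tu.
  have [x2 [y2 [? ? e2]]] := corner m hm; have [x1 [y1 [? ? e1]]] := corner k hk.
  exists x1, y1, x2, y2; split=> // x y /andP[? ?] /andP[? ?].
  rewrite -e1 -e2; apply/andP; split; [exact: linl | exact: lin].
- have M0 : 0 < `|N| + 1 by have := normr_ge0 N; lra.
  have NM : N <= `|N| + 1 by have := ler_norm N; lra.
  set M := `|N| + 1 in M0 NM.
  exists (e / (2 * M)); first by rewrite divr_gt0 // mulr_gt0.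
  move=> x x' y y' xN x'N yN y'N xx yy.
  have -> : x * y - x' * y' = x * (y - y') + (x - x') * y' by ring.
  apply: le_lt_trans (ler_normD _ _) _; rewrite !normrM.
  have hM : M * (e / (2 * M)) = e / 2 by field; rewrite gt_eqF.
  have a1 : `|x| * `|y - y'| <= M * `|y - y'|.
    by apply: ler_wpM2r => //; apply: le_trans xN NM.
  have a2 : `|x - x'| * `|y'| <= M * `|x - x'|.
    by rewrite mulrC; apply: ler_wpM2r => //; apply: le_trans y'N NM.
  have b1 : M * `|y - y'| < e / 2 by rewrite -hM ltr_pM2l.
  have b2 : M * `|x - x'| < e / 2 by rewrite -hM ltr_pM2l.
  lra.
Qed.

Lemma norm_bound (a b x : rat) : a < x < b -> `|x| <= `|a| + `|b|.
Proof.
move=> hx; have [? ?] := (lerNnormlW (lexx `|a|), ler_norm b).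
by rewrite ler_norml; have [? ?] := (normr_ge0 a, normr_ge0 b); lra.
Qed.

Lemma norm_diff (k c x y : rat) :
  c - k / 2 < x < c + k / 2 -> c - k / 2 < y < c + k / 2 -> `|x - y| < k.
Proof. by rewrite ltr_norml; lra. Qed.

Section Operations.
Context d (L : frameType d).
Implicit Types (phi psi chi : RL L).

Definition op_val (f : rat -> rat -> rat) phi psi (p q : rat) : L :=
  \fsup [set a | exists r s t u : rat,
    (forall x y : rat, r < x < s -> t < y < u -> p < f x y < q) /\
    a = (rval phi r s `&` rval psi t u)%O]%classic.

Lemma op_val_ub f phi psi (p q r s t u : rat) :
  (forall x y : rat, r < x < s -> t < y < u -> p < f x y < q) ->
  rval phi r s `&` rval psi t u <= op_val f phi psi p q.
Proof. by move=> h; apply: fsup_ub; exists r, s, t, u. Qed.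

Lemma op_val_mono f phi psi (p q r s : rat) :
  r <= p -> q <= s -> op_val f phi psi p q <= op_val f phi psi r s.
Proof.
move=> rp qs; apply: fsup_le => _ [a [b [c [e [h ->]]]]].
by apply: op_val_ub => x y hx hy; have := h x y hx hy; lra.
Qed.

Lemma op_relations f phi psi : tame_op f -> real_relations (op_val f phi psi).
Proof.
move=> tf; split.
- move=> p q r s; apply/le_anti/andP; split; last first.
    by rewrite lexI !op_val_mono // ?le_max ?ge_min lexx ?orbT.
  apply: meet_fsup_le => _ [a [b [c [e [h ->]]]]]; rewrite meetC.
  apply: meet_fsup_le => _ [a' [b' [c' [e' [h' ->]]]]].
  rewrite meetACA !rvalI; apply: op_val_ub => x y.
  rewrite !gt_max !lt_min => /andP[/andP[? ?] /andP[? ?]] /andP[/andP[? ?] /andP[? ?]].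
  have /andP[-> ->] : r < f x y < s by apply: h; lra.
  by have /andP[-> ->] : p < f x y < q by apply: h'; lra.
- move=> p q r s pr rq qs; apply/le_anti/andP; split.
    by rewrite leUx !op_val_mono //; lra.
  apply: fsup_le => _ [a [b [c [e [h ->]]]]].
  pose N := `|a| + `|b| + `|c| + `|e|.
  have [Nab Nce] : `|a| + `|b| <= N /\ `|c| + `|e| <= N.
    by rewrite /N -addrA; split; rewrite ?lerDl ?lerDr addr_ge0.
  have qr0 : 0 < q - r by lra.
  have [k k0 hk] := tame_continuous tf N qr0.
  have k20 : 0 < k / 2 by lra.
  apply: (rval_small (phi := phi) k20) => x0; apply: (rval_small (phi := psi) k20) => y0.
  rewrite -[X in X <= _]meetA meetACA !rvalI.
  set a' := Num.max _ _; set b' := Num.min _ _; set c' := Num.max _ _; set e' := Num.min _ _.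
  have box x y : a' < x < b' -> c' < y < e' ->
     [/\ a < x < b, c < y < e, x0 - k / 2 < x < x0 + k / 2 & y0 - k / 2 < y < y0 + k / 2].
    by rewrite /a' /b' /c' /e' !gt_max !lt_min => /andP[/andP[-> ->] /andP[-> ->]] /andP[/andP[-> ->] /andP[-> ->]].
  have [[x1 [y1 [hx1 hy1 f1]]]|no] := pselect (exists x1 y1 : rat, [/\ a' < x1 < b', c' < y1 < e' & f x1 y1 <= r]).
    apply: le_trans (leUl _ _); apply: op_val_ub => x y hx hy.
    have [g1 g2 g3 g4] := box _ _ hx hy; have [i1 i2 i3 i4] := box _ _ hx1 hy1.
    have := h _ _ g1 g2.
    have hN : `|f x y - f x1 y1| < q - r.
      apply: hk; [exact: le_trans (norm_bound g1) Nab
        |exact: le_trans (norm_bound i1) Nab|exact: le_trans (norm_bound g2) Nce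
        |exact: le_trans (norm_bound i2) Nce|exact: norm_diff g3 i3|exact: norm_diff g4 i4].
    move: hN f1; rewrite ltr_norml; clear; lra.
  apply: le_trans (leUr _ _); apply: op_val_ub => x y hx hy.
  have [g1 g2 _ _] := box _ _ hx hy; have /andP[_ ->] := h _ _ g1 g2.
  rewrite andbT ltNge; apply/negP => fr; apply: no; by exists x, y.
- move=> p q; apply/le_anti/andP; split; last first.
    by apply: fsup_le => _ [r [s [pr rs sq ->]]]; apply: op_val_mono; lra.
  apply: fsup_le => _ [a [b [c [e [h ->]]]]].
  apply: rval_inner => c1 e1 cc ce ee; rewrite meetC.
  apply: rval_inner => a1 b1 aa ab bb; rewrite meetC.
  have [x1 [y1 [x2 [y2 [h1 h2 hxy]]]]] := tame_extrema tf (ltW ab) (ltW ce).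
  have f1 : p < f x1 y1 < q by apply: h; lra.
  have f2 : p < f x2 y2 < q by apply: h; lra.
  have f12 : f x1 y1 <= f x2 y2 <= f x2 y2 by apply: hxy; lra.
  apply: (@le_trans _ _ (op_val f phi psi ((p + f x1 y1) / 2) ((f x2 y2 + q) / 2))).
    by apply: op_val_ub => x y hx hy; have : f x1 y1 <= f x y <= f x2 y2; [apply: hxy|]; lra.
  by apply: fsup_ub; exists ((p + f x1 y1) / 2), ((f x2 y2 + q) / 2); split=> //; lra.
- apply/le_anti; rewrite lex1 andbT.
  apply: (rval_bounded (phi := phi)) => N N0; apply: (rval_bounded (phi := psi)) => M M0.
  rewrite meet1x.
  have [] := @tame_extrema _ tf (- N) N (- M) M; try lra.
  move=> x1 [y1 [x2 [y2 [_ _ hxy]]]].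
  apply: (@le_trans _ _ (op_val f phi psi (f x1 y1 - 1) (f x2 y2 + 1))).
    by apply: op_val_ub => x y hx hy; have : f x1 y1 <= f x y <= f x2 y2; [apply: hxy|]; lra.
  by apply: fsup_ub; exists (f x1 y1 - 1), (f x2 y2 + 1).
Qed.

Definition RL_op f (tf : tame_op f) phi psi : RL L :=
  reals_hom (op_relations phi psi tf).

Definition cst_val (c p q : rat) : L := if p < c < q then \top else \bot.

Lemma cst_val_in (c p q : rat) : p < c < q -> cst_val c p q = \top.
Proof. by rewrite /cst_val => ->. Qed.

Lemma cst_val_out (c p q : rat) : ~ (p < c < q) -> cst_val c p q = \bot.
Proof. by rewrite /cst_val => /negP/negbTE ->. Qed.

Lemma cst_relations c : real_relations (cst_val c).
Proof.
split.
- move=> p q r s; rewrite /cst_val gt_max lt_min andbACA.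
  by case: (p < c < q) => /=; [rewrite meet1x | rewrite meet0x].
- move=> p q r s pr rq qs; have [h|h] := pselect (p < c < s).
    rewrite (cst_val_in h); have [rc|cr] := ltP r c.
      by rewrite (@cst_val_in c r s) ?joinx1 //; lra.
    by rewrite (@cst_val_in c p q) ?join1x //; lra.
  by rewrite !cst_val_out ?joinxx // => ?; apply: h; lra.
- move=> p q; apply/le_anti/andP; split.
    have [h|h] := pselect (p < c < q); last by rewrite cst_val_out ?le0x.
    apply: fsup_ub; exists ((p + c) / 2), ((c + q) / 2).
    have h' : (p + c) / 2 < c < (c + q) / 2 by lra.
    by rewrite (cst_val_in h) (cst_val_in h'); split=> //; lra.
  apply: fsup_le => _ [r [s [pr rs sq ->]]].
  have [h|h] := pselect (r < c < s); last by rewrite cst_val_out ?le0x.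
  by rewrite (@cst_val_in c p q) ?lex1 //; lra.
- apply/le_anti; rewrite lex1 andbT; apply: fsup_ub; exists (c - 1), (c + 1).
  by rewrite cst_val_in //; lra.
Qed.

Definition RL_cst (c : rat) : RL L := reals_hom (cst_relations c).

Definition opp_val phi (p q : rat) : L := rval phi (- q) (- p).

Lemma opp_relations phi : real_relations (opp_val phi).
Proof.
rewrite /opp_val; split.
- by move=> p q r s; rewrite rvalI oppr_min oppr_max.
- move=> p q r s pr rq qs; rewrite joinC.
  by apply: (rel_join (frame_hom_relations phi)); lra.
- move=> p q; rewrite {1}/rval (rel_sup (frame_hom_relations phi)).
  congr fsup; apply/seteqP; split=> x /= [r [s [h1 h2 h3 ->]]];
    exists (- s), (- r); rewrite ?opprK; split=> //; lra.
- rewrite (rel_top (frame_hom_relations phi)).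
  congr fsup; apply/seteqP; split=> x /= [p [q ->]]; exists (- q), (- p);
    by rewrite ?opprK.
Qed.

Definition RL_opp phi : RL L := reals_hom (opp_relations phi).

Lemma rval_ext g (hg : real_relations g) p q :
  rval (reals_hom hg : RL L) p q = g p q.
Proof. exact: reals_ext_gen. Qed.

End Operations.

(* [rep h chi] says that [chi] is the pointfree counterpart of
   [h (phi1, phi2, phi3)]; it determines [chi] and transfers identities from the
   rationals to real-valued functions. *)
Section Representation.
Context d (L : frameType d) (phi1 phi2 phi3 : RL L).
Implicit Types (chi : RL L) (h : rat -> rat -> rat -> rat).

Let near3 (x y z e : rat) : L :=
  rval phi1 (x - e) (x + e) `&` (rval phi2 (y - e) (y + e) `&` rval phi3 (z - e) (z + e)).

Let bounded3 (N x y z : rat) := [&& `|x| <= N, `|y| <= N & `|z| <= N].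

Let rep h chi : Prop :=
  (forall N, exists M, forall x y z, bounded3 N x y z -> `|h x y z| <= M) /\
  (forall N e : rat, 0 < e -> exists2 e' : rat, 0 < e' &
     forall x y z, bounded3 N x y z ->
       near3 x y z e' <= rval chi (h x y z - e) (h x y z + e)).

Let near3_le x y z (e e' : rat) : e <= e' -> near3 x y z e <= near3 x y z e'.
Proof. by move=> ee; rewrite !leI2 //; apply: rval_le; lra. Qed.

Let rep1 : rep (fun x _ _ => x) phi1.
Proof.
split=> [N|N e e0]; first by exists N => x y z /and3P[].
by exists e => // x y z _; apply: leIl.
Qed.

Let rep2 : rep (fun _ y _ => y) phi2.
Proof.
split=> [N|N e e0]; first by exists N => x y z /and3P[].
by exists e => // x y z _; apply: le_trans (leIr _ _) (leIl _ _).
Qed.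

Let rep3 : rep (fun _ _ z => z) phi3.
Proof.
split=> [N|N e e0]; first by exists N => x y z /and3P[].
by exists e => // x y z _; apply: le_trans (leIr _ _) (leIr _ _).
Qed.

Let rep_cst c : rep (fun _ _ _ => c) (RL_cst L c).
Proof.
split=> [N|N e e0]; first by exists `|c|.
exists 1 => // x y z _; by rewrite rval_ext cst_val_in ?lex1 //; lra.
Qed.

Let rep_opp h chi : rep h chi -> rep (fun x y z => - h x y z) (RL_opp chi).
Proof.
move=> [hb hc]; split=> [N|N e e0].
  by have [M hM] := hb N; exists M => x y z b; rewrite normrN; apply: hM.
have [k k0 hk] := hc N e e0; exists k => // x y z b.
apply: le_trans (hk _ _ _ b) _; rewrite rval_ext /opp_val.
by apply: rval_le; lra.
Qed.

Let rep_op f (tf : tame_op f) h1 h2 chi1 chi2 : rep h1 chi1 -> rep h2 chi2 ->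
  rep (fun x y z => f (h1 x y z) (h2 x y z)) (RL_op tf chi1 chi2).
Proof.
move=> [hb1 hc1] [hb2 hc2]; split=> [N|N e e0].
  have [[M1 hM1] [M2 hM2]] := (hb1 N, hb2 N).
  have [] := @tame_extrema _ tf (- `|M1|) `|M1| (- `|M2|) `|M2|;
    try by have := normr_ge0 M1; have := normr_ge0 M2; lra.
  move=> x1 [y1 [x2 [y2 [_ _ hxy]]]].
  exists (`|f x1 y1| + `|f x2 y2|) => x y z b.
  have : f x1 y1 <= f (h1 x y z) (h2 x y z) <= f x2 y2.
    apply: hxy; rewrite -ler_norml.
      by apply: le_trans (hM1 _ _ _ b) (ler_norm _).
    by apply: le_trans (hM2 _ _ _ b) (ler_norm _).
  have [? ?] := (lerNnormlW (lexx `|f x1 y1|), ler_norm (f x2 y2)).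
  by rewrite ler_norml; have [? ?] := (normr_ge0 (f x1 y1), normr_ge0 (f x2 y2)); lra.
have [[M1 hM1] [M2 hM2]] := (hb1 N, hb2 N).
pose M := `|M1| + `|M2| + 1.
have [k k0 hk] := tame_continuous tf M e0.
pose k' := Num.min k 1.
have [k'0 k'k k'1] : [/\ 0 < k', k' <= k & k' <= 1].
  by rewrite /k'; case: (leP k 1) => ?; split; lra.
have [l1 l10 hl1] := hc1 N k' k'0; have [l2 l20 hl2] := hc2 N k' k'0.
exists (Num.min l1 l2); first by rewrite lt_min l10.
move=> x y z b; rewrite rval_ext.
apply: (@le_trans _ _ (rval chi1 (h1 x y z - k') (h1 x y z + k') `&`
                       rval chi2 (h2 x y z - k') (h2 x y z + k'))).
  rewrite lexI; apply/andP; split.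
    by apply: le_trans (hl1 _ _ _ b); apply: near3_le; rewrite ge_min lexx.
  by apply: le_trans (hl2 _ _ _ b); apply: near3_le; rewrite ge_min lexx orbT.
apply: op_val_ub => u v hu hv.
have [n1 n2] := (le_trans (hM1 _ _ _ b) (ler_norm _), le_trans (hM2 _ _ _ b) (ler_norm _)).
have [? ?] := (normr_ge0 M1, normr_ge0 M2).
have : `|f u v - f (h1 x y z) (h2 x y z)| < e.
  move: n1 n2; rewrite !ler_norml => n1 n2.
  by apply: hk; rewrite /M ?ler_norml ?ltr_norml; lra.
by rewrite ltr_norml; lra.
Qed.

Let rep_unique h chi chi' : rep h chi -> rep h chi' -> chi = chi'.
Proof.
move=> [hb hc] [_ hc']; apply: rval_close_eq => e e0 x0 y0 H.
apply: (rval_bounded (phi := phi1)) => N1 N10.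
apply: (rval_bounded (phi := phi2)) => N2 N20.
apply: (rval_bounded (phi := phi3)) => N3 N30.
pose N := N1 + N2 + N3 + 1.
have [k k0 hk] := hc N e e0; have [k' k'0 hk'] := hc' N e e0.
pose l := Num.min (Num.min k k') 1.
have [l0 lk lk' l1] : [/\ 0 < l, l <= k, l <= k' & l <= 1].
  by split; rewrite /l ?lt_min ?ge_min ?k0 ?k'0 ?lexx ?orbT.
apply: (rval_small (phi := phi1) l0) => x.
apply: (rval_small (phi := phi2) l0) => y.
apply: (rval_small (phi := phi3) l0) => z.
have out (phi : RL L) (M c : rat) : 0 < M -> M + 1 <= N -> ~~ (`|c| <= N) ->
    rval phi (- M) M `&` rval phi (c - l) (c + l) = \bot.
  move=> M0 MN; rewrite ler_norml negb_and -!ltNge rvalI => cN.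
  apply: rval_bot; rewrite ge_min !le_max.
  by case/orP: cN => cN; [have -> : c + l <= - M by lra | have -> : M <= c - l by lra];
    rewrite ?orbT.
set A1 := rval phi1 _ _; set A2 := rval phi2 _ _; set A3 := rval phi3 _ _.
set B1 := rval phi1 _ _; set B2 := rval phi2 _ _; set B3 := rval phi3 _ _.
set T := (X in X <= _).
have TA : T = ((((x0 `&` A1) `&` A2) `&` A3) `&` B1) `&` B2 `&` B3 by [].
have TB : T <= near3 x y z l.
  rewrite /near3 TA -/B1 -/B2 -/B3 !lexI leIr andbT; apply/andP; split.
    exact: le_trans (leIl _ _) (le_trans (leIl _ _) (leIr _ _)).
  exact: le_trans (leIl _ _) (leIr _ _).
have TR : T = x0 `&` (A1 `&` (A2 `&` (A3 `&` (B1 `&` (B2 `&` B3))))).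
  by rewrite TA -!meetA.
have TA1 : T <= A1 `&` B1.
  rewrite TR lexI; apply/andP; split; [(do 1!apply: leIxr; exact: leIl) | (do 4!apply: leIxr; exact: leIl)].
have TA2 : T <= A2 `&` B2.
  rewrite TR lexI; apply/andP; split; [(do 2!apply: leIxr; exact: leIl) | (do 5!apply: leIxr; exact: leIl)].
have TA3 : T <= A3 `&` B3.
  rewrite TR lexI; apply/andP; split; [(do 3!apply: leIxr; exact: leIl) | (do 5!apply: leIxr; exact: leIr)].
have Tx0 : T <= x0 by rewrite TR leIl.
have [bx|nx] := boolP (`|x| <= N); last first.
  by apply: le_trans TA1 _; rewrite out ?le0x // /N; lra.
have [by_|ny] := boolP (`|y| <= N); last first.
  by apply: le_trans TA2 _; rewrite out ?le0x // /N; lra.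
have [bz|nz] := boolP (`|z| <= N); last first.
  by apply: le_trans TA3 _; rewrite out ?le0x // /N; lra.
have b : bounded3 N x y z by apply/and3P.
apply: le_trans (H (h x y z)); rewrite lexI Tx0 /= lexI; apply/andP; split.
  exact: le_trans TB (le_trans (near3_le _ _ _ lk) (hk _ _ _ b)).
exact: le_trans TB (le_trans (near3_le _ _ _ lk') (hk' _ _ _ b)).
Qed.

Local Notation add := (RL_op tame_add).
Local Notation mul := (RL_op tame_mul).

Let rep_eq h h' chi chi' : rep h chi -> rep h' chi' ->
  (forall x y z, h x y z = h' x y z) -> chi = chi'.
Proof.
move=> hh hh' E; apply: rep_unique hh _; suff -> : h = h' by [].
by apply: funext => x; apply: funext => y; apply: funext => z.
Qed.

Let rep_add h1 h2 chi1 chi2 := @rep_op _ tame_add h1 h2 chi1 chi2.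
Let rep_mul h1 h2 chi1 chi2 := @rep_op _ tame_mul h1 h2 chi1 chi2.

Lemma RL_addA : add phi1 (add phi2 phi3) = add (add phi1 phi2) phi3.
Proof.
apply: (rep_eq (rep_add rep1 (rep_add rep2 rep3)) (rep_add (rep_add rep1 rep2) rep3)).
by move=> x y z; rewrite addrA.
Qed.

Lemma RL_addC : add phi1 phi2 = add phi2 phi1.
Proof.
by apply: (rep_eq (rep_add rep1 rep2) (rep_add rep2 rep1)) => x y z; rewrite addrC.
Qed.

Lemma RL_add0 : add (RL_cst L 0) phi1 = phi1.
Proof. by apply: (rep_eq (rep_add (rep_cst 0) rep1) rep1) => x y z; rewrite add0r. Qed.

Lemma RL_addN : add (RL_opp phi1) phi1 = RL_cst L 0.
Proof.
by apply: (rep_eq (rep_add (rep_opp rep1) rep1) (rep_cst 0)) => x y z; rewrite addNr.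
Qed.

Lemma RL_mulA : mul phi1 (mul phi2 phi3) = mul (mul phi1 phi2) phi3.
Proof.
apply: (rep_eq (rep_mul rep1 (rep_mul rep2 rep3)) (rep_mul (rep_mul rep1 rep2) rep3)).
by move=> x y z; rewrite mulrA.
Qed.

Lemma RL_mulC : mul phi1 phi2 = mul phi2 phi1.
Proof.
by apply: (rep_eq (rep_mul rep1 rep2) (rep_mul rep2 rep1)) => x y z; rewrite mulrC.
Qed.

Lemma RL_mul1 : mul (RL_cst L 1) phi1 = phi1.
Proof. by apply: (rep_eq (rep_mul (rep_cst 1) rep1) rep1) => x y z; rewrite mul1r. Qed.

Lemma RL_mulDl : mul (add phi1 phi2) phi3 = add (mul phi1 phi3) (mul phi2 phi3).
Proof.
apply: (rep_eq (rep_mul (rep_add rep1 rep2) rep3)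
               (rep_add (rep_mul rep1 rep3) (rep_mul rep2 rep3))).
by move=> x y z; rewrite mulrDl.
Qed.

End Representation.

HB.instance Definition _ d (L : frameType d) := gen_eqMixin (RL L).
HB.instance Definition _ d (L : frameType d) := gen_choiceMixin (RL L).

HB.instance Definition _ d (L : frameType d) := GRing.isZmodule.Build (RL L)
  (@RL_addA d L) (fun phi psi => RL_addC phi psi psi)
  (fun phi => RL_add0 phi phi phi) (fun phi => RL_addN phi phi phi).

HB.instance Definition _ d (L : frameType d) :=
  GRing.Zmodule_isComPzRing.Build (RL L)
    (@RL_mulA d L) (fun phi psi => RL_mulC phi psi psi)
    (fun phi => RL_mul1 phi phi phi) (@RL_mulDl d L).

Lemma RL_addE d (L : frameType d) (phi psi : RL L) (p q : rat) :
  rval (phi + psi)%R p q = \fsup [set a | exists r s t u : rat,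
    (forall x y : rat, r < x < s -> t < y < u -> p < (x + y)%R < q) /\
    a = (rval phi r s `&` rval psi t u)%O]%classic.
Proof. exact: rval_ext. Qed.

Lemma RL_mulE d (L : frameType d) (phi psi : RL L) (p q : rat) :
  rval (phi * psi)%R p q = \fsup [set a | exists r s t u : rat,
    (forall x y : rat, r < x < s -> t < y < u -> p < (x * y)%R < q) /\
    a = (rval phi r s `&` rval psi t u)%O]%classic.
Proof. exact: rval_ext. Qed.

Section CozeroElements.
Context d (L : frameType d).

Definition coz (phi : RL L) : L :=
  \fsup [set a | exists p q : rat, a = (rval phi p 0 `|` rval phi 0 q)%O]%classic.

Definition Coz : set L := [set coz phi | phi in setT]%classic.

Definition PF_frame : Prop :=
  forall a b : L, Coz a -> Coz b -> a `&` b = \bot ->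
    complemented a \/ complemented b.

End CozeroElements.

Section Ideals.
Context (R : comPzRingType).
Implicit Types I J : set R.

(* Ideals may be improper; properness of [I] is stated as [I <> setT]. *)
Definition is_ideal I : Prop :=
  [/\ I 0%R, (forall a b, I a -> I b -> I (a + b)%R) &
      (forall a b, I b -> I (a * b)%R)].

Definition ideal_sum I J : set R := [set (a + b)%R | a in I & b in J]%classic.

End Ideals.

Definition z_ideal d (L : frameType d) (I : set (RL L)) : Prop :=
  is_ideal I /\ forall alpha phi : RL L, I phi -> coz alpha = coz phi -> I alpha.

(* Main.v *)
Require Import Defs.
From mathcomp Require Import all_boot all_order all_algebra.
From mathcomp Require Import boolp classical_sets.
From mathcomp Require Import ring lra.

(** The ring of real-valued continuous functions behaves, as far as this
    theorem is concerned, like a ring C(X).  Three facts carry the proof.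

    First, [coz f] is complemented exactly when [f] is von Neumann regular
    ([regular_complemented], [complemented_regular]), so [L] is a P_F-frame iff
    of two functions with product 0 at least one is regular ([PF_frameP]).  An
    ideal that contains [phi] contains every regular [f] with
    [coz f <= coz phi] ([regular_mem]).

    Second, in a P_F-frame all failure of regularity sits at one place.  Call
    an idempotent [e] cosmall if every multiple of [1 - e] is regular; of two
    complementary idempotents one is cosmall ([cosmall_or]), so the cosmall
    idempotents play the role of the clopen neighbourhoods of a single point.
    Given [f] and [g], the positive and the negative part of [f^2 - g^2] have
    product 0, so one of them vanishes on a cosmall idempotent [e]; there
    [f^2 <= g^2] or conversely, and division of functions gives
    [f^4 e] in [(g^2)] or [g^4 e] in [(f^2)] ([comparable_powers]).  This is a
    weak form of the statement that the ring is a valuation ring at that point: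
    it loses a power.  The loss is harmless, because a function that witnesses
    that an ideal is not a z-ideal may be replaced by an iterated cube root,
    which has the same cozero element ([not_z_ideal]).  With these two tools
    the statements on sums and on intersections follow as for ideals of a
    valuation ring, whose sum and intersection are the larger and the smaller one
    ([z_ideal_of_sum], [z_ideal_of_cap]).

    Third, if [(f) + {h | coz h <= coz g}] is a z-ideal, where [f g = 0], then it
    contains the cube root of [f], and this forces [f] to be regular
    ([complemented_of_z_ideal]).  If [f g = 0] and neither cozero element is
    complemented, then the ideals [(f)] and [(g)] intersect in 0, which
    contradicts the statement on intersections, while
    [(f) + {h | coz h <= coz g}] and [(g) + {h | coz h <= coz f}] add up to
    [{h | coz h <= coz f v coz g}] ([splitting]), a proper z-ideal, which
    contradicts the statement on sums.

    Apart from cube roots and characteristic functions, all functions that are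
    needed are composites of given functions with maps on rational points, which
    need not be continuous everywhere.  The existence principle
    [represents_exists] produces such composites, and by the uniqueness principle
    [represents_unique] identities between them follow from identities between
    rational numbers. *)

Set Implicit Arguments.
Unset Strict Implicit.
Unset Printing Implicit Defensive.

Import Order.TTheory GRing.Theory Num.Theory.
Local Open Scope ring_scope.
Local Open Scope order_scope.

(** * Estimates on the rationals *)

Lemma half_pos (e : rat) : 0 < e -> 0 < e / 2.
Proof. by lra. Qed.

Lemma norm_near (u c : rat) : `|u - c| < 1 -> `|u| <= `|c| + 1.
Proof.
have := ler_normD (u - c) c; rewrite subrK.
by move: `|_ - _| `|u| `|c| => *; lra.
Qed.

Lemma dist_half (e u v c : rat) :
  `|u - c| < e / 2 -> `|v - c| < e / 2 -> `|u - v| < e.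
Proof. by rewrite !ltr_norml; lra. Qed.

(** Division is uniformly continuous on bounded sets on which the denominator
    stays away from 0. *)
Lemma div_close (rho N e : rat) : 0 < rho -> 0 < e ->
  exists2 e' : rat, 0 < e' & forall u u' v v' : rat,
    rho <= `|u| -> rho <= `|u'| -> `|u| <= N -> `|u'| <= N -> `|v| <= N ->
    `|v'| <= N -> `|u - u'| < e' -> `|v - v'| < e' -> `|v / u - v' / u'| < e.
Proof.
move=> r0 e0; have N0 := normr_ge0 N.
have d0 : 0 < 2 * (`|N| + 1) by lra.
have r20 : 0 < rho * rho by rewrite mulr_gt0.
exists (e * (rho * rho) / (2 * (`|N| + 1))); first by rewrite divr_gt0 // mulr_gt0.
move=> u u' v v' ru ru' uN _ vN _ uu vv.
have u0 : u != 0 by rewrite -normr_gt0; apply: lt_le_trans ru.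
have u'0 : u' != 0 by rewrite -normr_gt0; apply: lt_le_trans ru'.
have -> : v / u - v' / u' = (u * (v - v') - v * (u - u')) / (u * u').
  by field; rewrite u0 u'0.
rewrite normrM normfV ltr_pdivrMr ?normr_gt0 ?mulf_neq0 // normrM.
apply: (@lt_le_trans _ _ (e * (rho * rho))); last first.
  rewrite ler_wpM2l ?(ltW e0) //; apply: ler_pM => //; exact: ltW.
apply: le_lt_trans (ler_normB _ _) _; rewrite !normrM.
have NN := ler_norm N.
set t := e * (rho * rho) / (2 * (`|N| + 1)) in uu vv.
have -> : e * (rho * rho) = (`|N| + 1) * t + (`|N| + 1) * t.
  by rewrite /t; field; rewrite gt_eqF //; lra.
apply: ler_ltD; first by apply: ler_pM => //; [lra | exact: ltW].
apply: (@le_lt_trans _ _ (`|N| * `|u - u'|)).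
  by apply: ler_wpM2r => //; lra.
apply: (@le_lt_trans _ _ ((`|N| + 1) * `|u - u'|)).
  by apply: ler_wpM2r => //; lra.
by rewrite ltr_pM2l //; lra.
Qed.

Lemma posdiff_close (N e : rat) : 0 < e -> exists2 e' : rat, 0 < e' &
  forall u u' v v' : rat, True -> True -> `|u| <= N -> `|u'| <= N ->
    `|v| <= N -> `|v'| <= N -> `|u - u'| < e' -> `|v - v'| < e' ->
    `|Num.max 0 (u - v) - Num.max 0 (u' - v')| < e.
Proof.
move=> e0; exists (e / 2); first exact: half_pos.
move=> u u' v v' _ _ _ _ _ _; rewrite !ltr_norml => uu vv.
by case: (leP 0 (u - v)) => h; case: (leP 0 (u' - v')) => h'; lra.
Qed.

Lemma cube_le (p q : rat) : p <= q -> p * p * p <= q * q * q.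
Proof.
move=> pq; rewrite -subr_ge0.
have -> : q * q * q - p * p * p
   = (q - p) * ((q + p / 2) * (q + p / 2) + 3 / 4 * (p * p)) by field.
have s1 := sqr_ge0 (q + p / 2); have s2 := sqr_ge0 p; rewrite !expr2 in s1 s2.
by apply: mulr_ge0; [rewrite subr_ge0 | lra].
Qed.

Lemma cube_lt (p q : rat) : p < q -> p * p * p < q * q * q.
Proof.
move=> pq; rewrite -subr_gt0.
have -> : q * q * q - p * p * p
  = (q - p) * ((q - p) * (q - p) / 4 + 3 / 4 * ((q + p) * (q + p))) by field.
have qp : 0 < q - p by rewrite subr_gt0.
have s1 : 0 < (q - p) * (q - p) by apply: mulr_gt0.
have s2 := sqr_ge0 (q + p); rewrite expr2 in s2.
by apply: mulr_gt0 => //; lra.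
Qed.

(** The cube is continuous from the right; [t] is chosen so small that the
    increment [t (3 p^2 + 3 p t + t^2)] is at most half of [c - p^3]. *)
Lemma cube_right (p c : rat) : p * p * p < c ->
  exists2 r, p < r & r * r * r < c.
Proof.
move=> pc; have n0 := normr_ge0 p; have pn := ler_norm p.
pose K := 3 * (p * p) + 3 * `|p| + 1.
have K0 : 0 < K by rewrite /K; have := sqr_ge0 p; rewrite expr2; lra.
pose t := Num.min 1 ((c - p * p * p) / (2 * K)).
have t0 : 0 < t by rewrite lt_min ltr01 divr_gt0 ?subr_gt0 ?mulr_gt0.
have t1 : t <= 1 by rewrite ge_min lexx.
have tK : t * K <= (c - p * p * p) / 2.
  have -> : (c - p * p * p) / 2 = (c - p * p * p) / (2 * K) * K.
    by field; rewrite gt_eqF.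
  by rewrite ler_wpM2r ?(ltW K0) // ge_min lexx orbT.
exists (p + t); first by rewrite ltrDl.
have -> : (p + t) * (p + t) * (p + t)
  = p * p * p + t * (3 * (p * p) + 3 * (p * t) + t * t) by ring.
have tt1 : t * t <= 1 by nra.
have pt : p * t <= `|p|.
  apply: le_trans (ler_norm _) _; rewrite normrM (ger0_norm (ltW t0)).
  by rewrite ler_piMr.
have : t * (3 * (p * p) + 3 * (p * t) + t * t) <= t * K.
  by rewrite ler_pM2l // /K; lra.
lra.
Qed.

Lemma cube_left (q c : rat) : c < q * q * q ->
  exists2 s, s < q & c < s * s * s.
Proof.
move=> cq; have [|r qr rc] := @cube_right (- q) (- c); first by rewrite mulrNN mulrN ltrN2.
exists (- r); first by rewrite ltrNl.
by move: rc; rewrite mulrNN mulrN ltrNr.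
Qed.

Lemma cube_max (p q : rat) :
  Num.max p q * Num.max p q * Num.max p q = Num.max (p * p * p) (q * q * q).
Proof.
by case: (leP p q) => [/cube_le|/cube_lt/ltW] h;
  rewrite ?(max_idPr h) ?(max_idPl h).
Qed.

Lemma cube_min (p q : rat) :
  Num.min p q * Num.min p q * Num.min p q = Num.min (p * p * p) (q * q * q).
Proof.
by case: (leP p q) => [/cube_le|/cube_lt/ltW] h;
  rewrite ?(min_idPr h) ?(min_idPl h).
Qed.

Lemma cube_close (N e : rat) : 0 < e -> exists2 e' : rat, 0 < e' &
  forall u v, `|u| <= N -> `|v| <= N -> `|u - v| <= e' ->
    `|u * u * u - v * v * v| < e.
Proof.
move=> e0; have N0 : 0 <= N * N by rewrite -expr2 sqr_ge0.
have d0 : 0 < 3 * (N * N) + 1 by lra.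
exists (e / (3 * (N * N) + 1)) => [|u v uN vN uv]; first by rewrite divr_gt0.
have -> : u * u * u - v * v * v = (u - v) * (u * u + u * v + v * v) by ring.
have bd a b : `|a| <= N -> `|b| <= N -> `|a * b| <= N * N.
  by move=> aN bN; rewrite normrM ler_pM.
have h : `|u * u + u * v + v * v| <= 3 * (N * N).
  have := ler_normD (u * u + u * v) (v * v); have := ler_normD (u * u) (u * v).
  have := bd u u uN uN; have := bd u v uN vN; have := bd v v vN vN.
  by move: `|_ * _| `|_ * _| `|_ * _| => ? ? ?; lra.
rewrite normrM; apply: (@le_lt_trans _ _ (e / (3 * (N * N) + 1) * (3 * (N * N)))).
  exact: ler_pM.
by rewrite mulrAC ltr_pdivrMr // ltr_pM2l //; lra.
Qed.

(** * Functions on a frame represented by maps on points *)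

Ltac meet_in := first [exact: lexx | assumption
  | apply: leIxl; meet_in | apply: leIxr; meet_in].
Ltac meets := rewrite ?lexI; repeat (apply/andP; split); meet_in.

(** [T A] stands for the open part on which an imaginary point with values
    in [X] lies in the interior of [A].  Only finite meets are required of [T];
    joins of sets are not preserved, since interiors do not preserve them. *)
Record test_map d (L : frameType d) (X : Type) (T : set X -> L) : Prop := {
  test_setT : T setT = \top;
  test_set0 : T set0 = \bot;
  test_setI : forall A B, T (A `&` B)%classic = T A `&` T B
}.

Section Representation.
Context d (L : frameType d) (X : Type) (T : set X -> L) (hT : test_map T).
Implicit Types (a x y : L) (F G : X -> rat) (k : RL L) (A B : set X).

Definition fibre F (c e : rat) : set X := [set p | `|F p - c| < e]%classic.
Definition near k (c e : rat) : L := rval k (c - e) (c + e).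

(** The element [a] is covered by parts on which [F] oscillates by less than
    [2 e], for every [e]. *)
Definition continuous_on a F : Prop := forall e, 0 < e -> forall x y,
  x <= a -> (forall c, x `&` T (fibre F c e) <= y) -> x <= y.

(** [k] is the composite of [F] with the point described by [T]: for every [e]
    the frame is covered by parts on which [F] and [k] are both within [e] of a
    common rational.  This contains the continuity of [F], which makes the
    relation functional and stable under composition. *)
Definition represents F k : Prop := forall e, 0 < e -> forall x y,
  (forall c, x `&` (T (fibre F c e) `&` near k c e) <= y) -> x <= y.

Lemma test_le A B : (A `<=` B)%classic -> T A <= T B.
Proof.
by move=> AB; rewrite leEmeet -(test_setI hT) (setIidl AB).
Qed.

(** The content of [T set0 = \bot]: an inequality below [T A] may be proved
    with a point of [A] at hand. *)
Lemma test_point A x y : (forall p, A p -> x `&` T A <= y) -> x `&` T A <= y.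
Proof.
move=> h; have [[p Ap]|nA] := pselect (exists p, A p); first exact: h Ap.
suff -> : A = set0 by rewrite (test_set0 hT) meetx0 le0x.
by apply/seteqP; split=> p // Ap; apply: nA; exists p.
Qed.

Lemma represents_continuous a F k : represents F k -> continuous_on a F.
Proof.
move=> h e e0 x y _ hc; apply: (h e e0) => c.
by apply: le_trans (hc c); rewrite leI2 ?leIl.
Qed.

(** The bound [N] is needed because operations such as the product are uniformly
    continuous on bounded sets only; a first cover by parts of oscillation 1
    provides it, and a second one the smallness [e']. *)
Lemma continuous_comp (h : rat -> rat -> rat) (D : rat -> rat -> Prop) a F G :
  (forall N e : rat, 0 < e -> exists2 e' : rat, 0 < e' & forall u u' v v',
     D u v -> D u' v' -> `|u| <= N -> `|u'| <= N -> `|v| <= N -> `|v'| <= N ->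
     `|u - u'| < e' -> `|v - v'| < e' -> `|h u v - h u' v'| < e) ->
  continuous_on a F -> continuous_on a G ->
  a <= T [set p | D (F p) (G p)]%classic ->
  continuous_on a (fun p => h (F p) (G p)).
Proof.
move=> hh cF cG aD e e0 x y xa H.
apply: (cF 1) => // c1; apply: (cG 1) => // [|c2]; first by rewrite leIxl.
pose N := `|c1| + `|c2| + 1.
have [e' e'0 he'] := hh N e e0; have e'20 := half_pos e'0.
apply: (cF (e' / 2)) => // [|c3]; first by rewrite !leIxl.
apply: (cG (e' / 2)) => // [|c4]; first by rewrite !leIxl.
set D' := [set p | D (F p) (G p)]%classic in aD.
pose A := (fibre F c1 1 `&` (fibre G c2 1 `&`
  (fibre F c3 (e' / 2) `&` (fibre G c4 (e' / 2) `&` D'))))%classic.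
apply: (@le_trans _ _ (x `&` T A)).
  rewrite /A !(test_setI hT) !meetA lexI lexx /=.
  by rewrite !leIxl // (le_trans xa).
apply: test_point => p [p1 [p2 [p3 [p4 pD]]]].
apply: le_trans (H (h (F p) (G p))); apply: leI2 => //; apply: test_le.
move=> q [q1 [q2 [q3 [q4 qD]]]].
have N1 u : `|u - c1| < 1 -> `|u| <= N.
  by move/norm_near/le_trans; apply; rewrite lerD2r lerDl.
have N2 u : `|u - c2| < 1 -> `|u| <= N.
  by move/norm_near/le_trans; apply; rewrite lerD2r lerDr.
by apply: he' => //; [exact: N1 | exact: N1 | exact: N2 | exact: N2
  | exact: dist_half q3 p3 | exact: dist_half q4 p4].
Qed.

(** Two functions represented by the same map are locally arbitrarily close. *)
Lemma represents_unique F k k' : represents F k -> represents F k' -> k = k'.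
Proof.
move=> hk hk'; apply: rval_close_eq => e e0 x y H.
have e20 := half_pos e0; have e40 := half_pos e20.
apply: (hk _ e40) => c; apply: (hk' _ e40) => c'.
set n' := near k' _ _; set n := near k _ _.
set t := T (fibre F c _); set t' := T (fibre F c' _).
have -> : x `&` (t `&` n) `&` (t' `&` n') = (x `&` (n `&` n')) `&` (t `&` t').
  by apply/le_anti/andP; split; meets.
rewrite -(test_setI hT); apply: test_point => p [p1 p2]; rewrite leIxl //.
apply: le_trans (H c); rewrite leI2 // leI2 // rval_le //; move: p1 p2;
  rewrite /fibre /= !ltr_norml => *; clear H; lra.
Qed.

(** [tame_op] provides the uniform continuity on bounded sets; the values of
    [k] and [l] are compared with those of [F] and [G] at a common point. *)
Lemma represents_op f (tf : tame_op f) F G k l :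
  represents F k -> represents G l ->
  represents (fun p => f (F p) (G p)) (RL_op tf k l).
Proof.
move=> hk hl e e0 x y H.
apply: (hk 1) => // c1; apply: (hl 1) => // c2.
pose N := `|c1| + `|c2| + 1 + 1 + 1.
have [e' e'0 he'] := tame_continuous tf N e0.
pose e2 := Num.min e' 1.
have e20 : 0 < e2 by rewrite lt_min e'0.
have e2e' : e2 <= e' by rewrite ge_min lexx.
have e21 : e2 <= 1 by rewrite ge_min lexx orbT.
apply: (hk e2) => // c3; apply: (hl e2) => // c4.
pose A := (fibre F c1 1 `&` (fibre G c2 1 `&`
  (fibre F c3 e2 `&` fibre G c4 e2)))%classic.
pose n := near k c3 e2 `&` near l c4 e2.
apply: (@le_trans _ _ (x `&` n `&` T A)).
  by rewrite /A !(test_setI hT) /n; meets.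
apply: test_point => p [p1 [p2 [p3 p4]]].
have bound (c c' w v N' : rat) : `|w - c| < 1 -> `|w - c'| < e2 -> `|c| <= N' ->
    `|v - c'| < e2 -> `|v| <= N' + 1 + 1 + 1.
  move=> /norm_near wc; rewrite distrC => wc' cN vc'.
  have /norm_near c'w := lt_le_trans wc' e21.
  have /norm_near vN := lt_le_trans vc' e21.
  by rewrite (le_trans vN) // lerD2r (le_trans c'w) // lerD2r (le_trans wc) // lerD2r.
have N1 v : `|v - c3| < e2 -> `|v| <= N.
  by apply: bound p1 p3 _; rewrite lerDl.
have N2 v : `|v - c4| < e2 -> `|v| <= N.
  by apply: bound p2 p4 _; rewrite lerDr.
have close u v : `|u - c3| < e2 -> `|v - c4| < e2 -> `|f u v - f c3 c4| < e.
  move=> uc vc; have [cc1 cc2] : `|c3 - c3| < e2 /\ `|c4 - c4| < e2.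
    by rewrite !subrr normr0.
  by apply: he'; [exact: N1 | exact: N1 | exact: N2 | exact: N2
    | exact: lt_le_trans e2e' | exact: lt_le_trans e2e'].
apply: le_trans (H (f c3 c4)); rewrite !lexI leIxl ?leIl //=; apply/andP; split.
  by apply: leIxr; apply: test_le => q [_ [_ [q3 q4]]]; apply: close.
suff nk : n <= near (RL_op tf k l) (f c3 c4) e by apply: leIxl; apply: leIxr.
rewrite [leRHS]rval_ext; apply: op_val_ub => u v hu hv.
have := close u v; rewrite !ltr_distl; apply.
  by case/andP: hu => -> ->.
by case/andP: hv => -> ->.
Qed.

Let ext_val F (p q : rat) : L :=
  \fsup [set a | exists r s : rat, [/\ p < r, s < q &
    a = T [set u | r < F u < s]%classic]]%classic.

Let ext_ub F (p q r s : rat) A : p < r -> s < q ->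
  (forall u, A u -> r < F u < s) -> T A <= ext_val F p q.
Proof.
move=> pr sq h; apply: (@le_trans _ _ (T [set u | r < F u < s]%classic)).
  exact: test_le.
by apply: fsup_ub; exists r, s.
Qed.

Let ext_mono F (p q r s : rat) :
  r <= p -> q <= s -> ext_val F p q <= ext_val F r s.
Proof.
move=> rp qs; apply: fsup_le => _ [r' [s' [pr' s'q ->]]].
by apply: (ext_ub (r := r') (s := s')) => //; lra.
Qed.

Let ext_relations F : continuous_on \top F -> real_relations (ext_val F).
Proof.
move=> cF; split.
- move=> p q r s; apply/le_anti/andP; split; last first.
    by rewrite lexI !ext_mono // ?le_max ?ge_min lexx ?orbT.
  apply: meet_fsup_le => _ [r' [s' [h1 h2 ->]]]; rewrite meetC.
  apply: meet_fsup_le => _ [p' [q' [h3 h4 ->]]]; rewrite -(test_setI hT).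
  apply: (ext_ub (r := Num.max p' r') (s := Num.min q' s')).
  + by rewrite gt_max !lt_max h1 h3 orbT.
  + by rewrite lt_min !gt_min h2 h4 orbT.
  + by move=> u [/= /andP[a1 a2] /andP[a3 a4]]; rewrite gt_max lt_min a1 a2 a3 a4.
- move=> p q r s pr rq qs; apply/le_anti/andP; split.
    by rewrite leUx !ext_mono //; lra.
  apply: fsup_le => _ [a [b [pa bs ->]]].
  have e0 : 0 < (q - r) / 4 by lra.
  apply: (cF _ e0) => [|c]; first exact: lex1.
  rewrite -(test_setI hT); have [cq|qc] := ltP (c + (q - r) / 4) q.
    apply: le_trans (leUl _ _).
    apply: (ext_ub (r := a) (s := c + (q - r) / 4)) => // u [/= au].
    by rewrite /fibre /= ltr_distl; lra.
  apply: le_trans (leUr _ _).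
  apply: (ext_ub (r := c - (q - r) / 4) (s := b)) => // [|u [/= au]]; first lra.
  by rewrite /fibre /= ltr_distl; lra.
- move=> p q; apply/le_anti/andP; split; last first.
    by apply: fsup_le => _ [r [s [pr rs sq ->]]]; apply: ext_mono; lra.
  apply: fsup_le => _ [a [b [pa bq ->]]]; rewrite -[leLHS]meet1x.
  apply: test_point => u /= ub; rewrite meet1x.
  apply: (@le_trans _ _ (ext_val F ((p + a) / 2) ((b + q) / 2))).
    by apply: (ext_ub (r := a) (s := b)) => //; lra.
  by apply: fsup_ub; exists ((p + a) / 2), ((b + q) / 2); split=> //; lra.
- apply/le_anti; rewrite lex1 andbT; apply: (cF 1) => // c; rewrite meet1x.
  apply: (@le_trans _ _ (ext_val F (c - 2) (c + 2))); last first.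
    by apply: fsup_ub; exists (c - 2), (c + 2).
  apply: (ext_ub (r := c - 1) (s := c + 1)); try lra.
  by move=> u; rewrite /fibre /= ltr_distl.
Qed.

(** Every map that is continuous with respect to [T] is represented: the value
    at [(p, q)] is the join of the [T [set u | r < F u < s]] with
    [p < r] and [s < q].  The strict inequalities yield the relation [rel_sup],
    continuity of [F] yields [rel_join] and [rel_top]. *)
Lemma represents_exists F :
  continuous_on \top F -> exists k, represents F k.
Proof.
move=> cF; exists (reals_hom (ext_relations cF)) => e e0 x y H.
have e20 := half_pos e0; apply: (cF _ e20) => [|c]; first exact: lex1.
apply: le_trans (H c); rewrite leI2 // lexI; apply/andP; split.
  by apply: test_le => u /= /lt_le_trans; apply; lra.
rewrite [leRHS]rval_ext; apply: (ext_ub (r := c - e / 2) (s := c + e / 2)); try lra.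
by move=> u; rewrite /fibre /= ltr_distl.
Qed.

End Representation.

Section Boxes.
Context d (L : frameType d) (phi1 phi2 phi3 : RL L).

(** The interior of a set of points of rational 3-space, pulled back along the
    triple [phi1, phi2, phi3]. *)
Definition box_test (A : set (rat * rat * rat)) : L :=
  \fsup [set a | exists r s t u v w : rat,
    (forall x y z, r < x < s -> t < y < u -> v < z < w -> A (x, y, z)) /\
    a = (rval phi1 r s `&` (rval phi2 t u `&` rval phi3 v w))%O]%classic.

Lemma box_test_ub (A : set (rat * rat * rat)) (r s t u v w : rat) :
  (forall x y z, r < x < s -> t < y < u -> v < z < w -> A (x, y, z)) ->
  rval phi1 r s `&` (rval phi2 t u `&` rval phi3 v w) <= box_test A.
Proof. by move=> h; apply: fsup_ub; exists r, s, t, u, v, w. Qed.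

Lemma box_testP : test_map box_test.
Proof.
split.
- apply/le_anti; rewrite lex1 /=.
  apply: (rval_cover (phi := phi1)) => r s; apply: (rval_cover (phi := phi2)) => t u.
  apply: (rval_cover (phi := phi3)) => v w; rewrite meet1x -meetA.
  exact: box_test_ub.
- apply/le_anti; rewrite le0x andbT.
  apply: fsup_le => _ [r [s [t [u [v [w [h ->]]]]]]].
  have [sr|rs] := leP s r; first by rewrite rval_bot // meet0x.
  have [ut|tu] := leP u t; first by rewrite (rval_bot phi2 ut) meet0x meetx0.
  have [wv|vw] := leP w v; first by rewrite (rval_bot phi3 wv) !meetx0.
  by have [] := h ((r + s) / 2) ((t + u) / 2) ((v + w) / 2); lra.
- move=> A B; apply/le_anti/andP; split.
    by rewrite lexI; apply/andP; split;
      apply: fsup_le => _ [r [s [t [u [v [w [h ->]]]]]]];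
      apply: box_test_ub => x y z hx hy hz; case: (h x y z).
  apply: meet_fsup_le => _ [r [s [t [u [v [w [h ->]]]]]]]; rewrite meetC.
  apply: meet_fsup_le => _ [r' [s' [t' [u' [v' [w' [h' ->]]]]]]].
  rewrite meetACA rvalI (meetACA (rval phi2 t u)) !rvalI.
  apply: box_test_ub => x y z; rewrite !gt_max !lt_min.
  move=> /andP[/andP[? ?] /andP[? ?]] /andP[/andP[? ?] /andP[? ?]]
    /andP[/andP[? ?] /andP[? ?]].
  by split; [apply: h' | apply: h]; apply/andP.
Qed.

Lemma box_test1 (r s : rat) :
  rval phi1 r s <= box_test [set p | r < p.1.1 < s]%classic.
Proof.
apply: (rval_cover (phi := phi2)) => t u; apply: (rval_cover (phi := phi3)) => v w.
by rewrite -meetA; apply: box_test_ub.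
Qed.

Lemma box_test2 (r s : rat) :
  rval phi2 r s <= box_test [set p | r < p.1.2 < s]%classic.
Proof.
apply: (rval_cover (phi := phi1)) => t u; apply: (rval_cover (phi := phi3)) => v w.
by rewrite (meetC (rval phi2 r s)) -meetA; apply: box_test_ub.
Qed.

Lemma box_test3 (r s : rat) :
  rval phi3 r s <= box_test [set p | r < p.2 < s]%classic.
Proof.
apply: (rval_cover (phi := phi1)) => t u; apply: (rval_cover (phi := phi2)) => v w.
rewrite -meetA meetC -meetA; apply: box_test_ub => // x y z hx hy hz /=.
Qed.

Lemma represents1 : represents box_test (fun p => p.1.1) phi1.
Proof.
move=> e e0 x y H; apply: (rval_small (phi := phi1) e0) => c.
apply: le_trans (H c); rewrite leI2 // lexI lexx andbT.
apply: le_trans (box_test1 _ _) _; apply: (test_le box_testP) => p /=.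
by rewrite /fibre /= ltr_distl.
Qed.

Lemma represents2 : represents box_test (fun p => p.1.2) phi2.
Proof.
move=> e e0 x y H; apply: (rval_small (phi := phi2) e0) => c.
apply: le_trans (H c); rewrite leI2 // lexI lexx andbT.
apply: le_trans (box_test2 _ _) _; apply: (test_le box_testP) => p /=.
by rewrite /fibre /= ltr_distl.
Qed.

Lemma represents3 : represents box_test (fun p => p.2) phi3.
Proof.
move=> e e0 x y H; apply: (rval_small (phi := phi3) e0) => c.
apply: le_trans (H c); rewrite leI2 // lexI lexx andbT.
apply: le_trans (box_test3 _ _) _; apply: (test_le box_testP) => p /=.
by rewrite /fibre /= ltr_distl.
Qed.

End Boxes.

Arguments represents1 {d L} phi1 phi2 phi3.
Arguments represents2 {d L} phi1 phi2 phi3.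
Arguments represents3 {d L} phi1 phi2 phi3.

(** * Cozero elements *)

Section Cozero.
Context d (L : frameType d).
Implicit Types (f g h : RL L) (a b x y : L).

Lemma rval_coz_neg f (p q : rat) : q <= 0 -> rval f p q <= coz f.
Proof.
move=> q0; apply: (@le_trans _ _ (rval f p 0 `|` rval f 0 0)).
  by rewrite lexUl // rval_le.
by apply: fsup_ub; exists p, 0.
Qed.

Lemma rval_coz_pos f (p q : rat) : 0 <= p -> rval f p q <= coz f.
Proof.
move=> q0; apply: (@le_trans _ _ (rval f 0 0 `|` rval f 0 q)).
  by rewrite lexUr // rval_le.
by apply: fsup_ub; exists 0, q.
Qed.

(** [coz f] is covered by the values of [f] at intervals bounded away from 0. *)
Lemma coz_cover f x y : x <= coz f ->
  (forall p q : rat, q < 0 \/ 0 < p -> x `&` rval f p q <= y) -> x <= y.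
Proof.
move=> xf h; apply: cover_le xf _ => _ [p [q ->]]; rewrite frame_meetUr leUx.
apply/andP; split; apply: rval_inner => r s pr rs sq; apply: h; [by left|by right].
Qed.

Lemma coz0 : coz (0 : RL L) = \bot.
Proof.
apply/le_anti; rewrite le0x andbT; apply: (coz_cover (lexx _)) => p q pq.
by rewrite [rval _ _ _]rval_ext cst_val_out ?meetx0 //; lra.
Qed.

Lemma coz1 : coz (1 : RL L) = \top.
Proof.
apply/le_anti; rewrite lex1 /=; apply: le_trans (@rval_coz_pos 1 0 2 _) => //.
by rewrite [rval _ _ _]rval_ext cst_val_in.
Qed.

(** Where [coz f] is the bottom, [f] takes its values in every neighbourhood of
    0, hence is as close to the constant 0 as desired. *)
Lemma coz_eq0 f : coz f = \bot -> f = 0.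
Proof.
move=> f0; apply: rval_close_eq => e e0 x y H; apply: (rval_cover (phi := f)) => p q.
have [le0 ge0] : rval f p (- (e / 2)) = \bot /\ rval f (e / 2) q = \bot.
  split; apply/le_anti; rewrite le0x -f0 andbT.
    by apply: rval_coz_neg; lra.
  by apply: rval_coz_pos; lra.
have top0 : rval (0 : RL L) (0 - e) (0 + e) = \top.
  by rewrite [rval _ _ _]rval_ext cst_val_in //; lra.
have := H 0; rewrite top0 meetx1; apply: le_trans; rewrite leI2 //.
have [q1|q1] := leP q (- (e / 2)).
  apply: le_trans (le0x _); rewrite -le0; exact: rval_le.
have [p1|p1] := leP (e / 2) p.
  apply: le_trans (le0x _); rewrite -ge0; exact: rval_le.
rewrite -[leLHS]meet1x; apply: (rval_small (phi := f) (e := e / 4)) => [|c].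
  by lra.
rewrite meet1x rvalI.
have [c1|c1] := leP (c + e / 4) (- (e / 2)).
  apply: le_trans (le0x _); rewrite -le0; apply: rval_le; rewrite ?le_max ?lexx //.
  by rewrite ge_min c1 orbT.
have [c2|c2] := leP (e / 2) (c - e / 4).
  apply: le_trans (le0x _); rewrite -ge0; apply: rval_le.
    by rewrite le_max c2 orbT.
  by rewrite ge_min lexx.
have [ce1 ce2] : 0 - e <= c - e / 4 /\ c + e / 4 <= 0 + e by split; lra.
by apply: rval_le; rewrite ?le_max ?ge_min ?ce1 ?ce2 orbT.
Qed.

(** In both directions this is the behaviour of signs: a box on which [x y]
    avoids 0 avoids 0 in both coordinates, and conversely. *)
Lemma cozM f g : coz (f * g) = coz f `&` coz g.
Proof.
apply/le_anti/andP; split.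
  have sgn (p q : rat) : q <= 0 \/ 0 <= p -> rval (f * g) p q <= coz f `&` coz g.
    move=> pq; rewrite RL_mulE; apply: fsup_le => _ [r [s [t [u [h ->]]]]].
    have [sr|rs] := leP s r; first by rewrite rval_bot // meet0x le0x.
    have [ut|tu] := leP u t; first by rewrite (rval_bot _ ut) meetx0 le0x.
    apply: leI2.
      have [s0|s0] := leP s 0; first exact: rval_coz_neg.
      have [r0|r0] := leP 0 r; first exact: rval_coz_pos.
      have : p < 0 * ((t + u) / 2) < q by apply: h; lra.
      by rewrite mul0r => hpq; exfalso; lra.
    have [u0|u0] := leP u 0; first exact: rval_coz_neg.
    have [t0|t0] := leP 0 t; first exact: rval_coz_pos.
    have : p < (r + s) / 2 * 0 < q by apply: h; lra.
    by rewrite mulr0 => hpq; exfalso; lra.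
  apply: (coz_cover (lexx _)) => p q pq; apply: leIxr; apply: sgn; lra.
apply: (coz_cover (leIl _ _)) => p q pq.
apply: (coz_cover (f := g)) => [|r s rs]; first by meets.
apply: (@le_trans _ _ (rval f p q `&` rval g r s)); first by meets.
case: pq rs => [q0|p0] [s0|r0].
- apply: le_trans (@rval_coz_pos _ (0) (p * r + 1) _) => //.
  by rewrite RL_mulE; apply: fsup_ub; exists p, q, r, s; split=> // x y hx hy; nra.
- apply: le_trans (@rval_coz_neg _ (p * s - 1) (0) _) => //.
  by rewrite RL_mulE; apply: fsup_ub; exists p, q, r, s; split=> // x y hx hy; nra.
- apply: le_trans (@rval_coz_neg _ (q * r - 1) (0) _) => //.
  by rewrite RL_mulE; apply: fsup_ub; exists p, q, r, s; split=> // x y hx hy; nra.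
- apply: le_trans (@rval_coz_pos _ (0) (q * s + 1) _) => //.
  by rewrite RL_mulE; apply: fsup_ub; exists p, q, r, s; split=> // x y hx hy; nra.
Qed.

Lemma cozD f g : coz (f + g) <= coz f `|` coz g.
Proof.
apply: (coz_cover (lexx _)) => p q pq; apply: leIxr.
rewrite RL_addE; apply: fsup_le => _ [r [s [t [u [h ->]]]]].
have [sr|rs] := leP s r; first by rewrite rval_bot // meet0x le0x.
have [ut|tu] := leP u t; first by rewrite (rval_bot _ ut) meetx0 le0x.
have [s0|s0] := leP s 0; first by rewrite leIxl // lexUl // rval_coz_neg.
have [r0|r0] := leP 0 r; first by rewrite leIxl // lexUl // rval_coz_pos.
have [u0|u0] := leP u 0; first by rewrite leIxr // lexUr // rval_coz_neg.
have [t0|t0] := leP 0 t; first by rewrite leIxr // lexUr // rval_coz_pos.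
have : p < 0 + 0 < q by apply: h; lra.
by rewrite addr0 => hpq; exfalso; lra.
Qed.

End Cozero.

(** * Division of represented functions *)

Section Construction.
Context d (L : frameType d) (X : Type) (T : set X -> L) (hT : test_map T).
Implicit Types (x y : L) (F G U V Z : X -> rat) (k l u v z : RL L).

Lemma represents_eq F G k l : represents T F k -> represents T G l ->
  F =1 G -> k = l.
Proof. by move=> hk hl /funext E; rewrite E in hk; apply: represents_unique hk hl. Qed.

Lemma representsM F G k l : represents T F k -> represents T G l ->
  represents T (fun p => F p * G p) (k * l).
Proof. exact: represents_op. Qed.

Lemma representsD F G k l : represents T F k -> represents T G l ->
  represents T (fun p => F p + G p) (k + l).
Proof. exact: represents_op. Qed.

Lemma represents0 : represents T (fun => 0) (0 : RL L).
Proof.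
move=> e e0 x y H; apply: le_trans (H 0); rewrite /near [rval _ _ _]rval_ext.
rewrite cst_val_in; last by lra.
rewrite meetx1 lexI lexx; apply: le_trans (lex1 _) _; rewrite -(test_setT hT).
by apply: (test_le hT) => p _; rewrite /fibre /= subrr normr0.
Qed.

(** Converse to the definition of representation, up to an arbitrarily small
    enlargement of the interval. *)
Lemma rval_test F k (p q e : rat) : represents T F k -> 0 < e ->
  rval k p q <= T [set t | p - e < F t < q + e]%classic.
Proof.
move=> hk e0; have e20 := half_pos e0; apply: (hk _ e20) => c.
set t := T (fibre _ _ _); set n := near _ _ _.
apply: (@le_trans _ _ ((rval k p q `&` n) `&` t)); first by meets.
rewrite /n /near rvalI.
set r := Num.max _ _; set s := Num.min _ _; have [sr|] := leP s r.
  by rewrite rval_bot // meet0x le0x.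
rewrite gt_max !lt_min => /andP[/andP[_ h1] /andP[h2 _]].
apply: leIxr; apply: (test_le hT) => w /=; rewrite /fibre /= ltr_distl.
by clear -h1 h2; lra.
Qed.

Lemma test_coz F k (rho : rat) : represents T F k -> 0 < rho ->
  T [set t | rho <= `|F t|]%classic <= coz k.
Proof.
move=> hk r0; have e20 := half_pos r0; apply: (hk _ e20) => c.
rewrite meetA -(test_setI hT) meetC.
apply: test_point => // w [/= w1 w2]; apply: leIxl.
have [w0|w0] := leP 0 (F w).
  by apply: rval_coz_pos; move: w1 w2; rewrite /fibre /= ger0_norm // ltr_distl; lra.
by apply: rval_coz_neg; move: w1 w2; rewrite /fibre /= ltr0_norm // ltr_distl; lra.
Qed.

Lemma coz_test_cover F k x y : represents T F k -> x <= coz k ->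
  (forall rho : rat, 0 < rho -> x `&` T [set t | rho <= `|F t|]%classic <= y) ->
  x <= y.
Proof.
move=> hk xk H; apply: (coz_cover xk) => p q [q0|p0].
  have q20 : 0 < - q / 2 by lra.
  apply: le_trans (H _ q20); rewrite leI2 //.
  apply: le_trans (rval_test p q hk q20) _; apply: (test_le hT) => w /= hw.
  by rewrite ler0_norm; lra.
apply: le_trans (H _ (half_pos p0)); rewrite leI2 //.
apply: le_trans (rval_test p q hk (half_pos p0)) _; apply: (test_le hT) => w /= hw.
by rewrite ger0_norm; lra.
Qed.

Lemma coz_represents_le F G k l : represents T F k -> represents T G l ->
  (forall rho : rat, 0 < rho -> exists2 rho' : rat, 0 < rho' &
     forall t, rho <= `|F t| -> rho' <= `|G t|) -> coz k <= coz l.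
Proof.
move=> hk hl H; apply: (coz_test_cover hk (lexx _)) => rho r0.
have [rho' r'0 h] := H _ r0; apply: leIxr; apply: le_trans (test_coz hl r'0).
exact: (test_le hT).
Qed.

Lemma coz_small k (e : rat) x y : 0 < e -> x `&` coz k <= y ->
  x `&` rval k (- e) e <= y -> x <= y.
Proof.
move=> e0 H1 H2; apply: (rval_small (phi := k) (half_pos e0)) => c.
have [c1|c1] := leP c (- (e / 2)).
  by apply: le_trans H1; rewrite leI2 // rval_coz_neg //; clear H2; lra.
have [c2|c2] := leP (e / 2) c.
  by apply: le_trans H1; rewrite leI2 // rval_coz_pos //; clear H2; lra.
by apply: le_trans H2; rewrite leI2 // rval_le //; lra.
Qed.

(** The quotient is continuous on [coz u], where the denominator is locally
    bounded away from 0, so it is enough that it be small outside [coz u]. *)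
Lemma quotient_exists U V u v : represents T U u -> represents T V v ->
  (forall (e : rat) x y, 0 < e -> x `&` coz u <= y ->
     x `&` T (fibre (fun t => V t / U t) 0 e) <= y -> x <= y) ->
  exists k, represents T (fun t => V t / U t) k.
Proof.
move=> hu hv H; apply: (represents_exists hT) => e e0 x y _ hc.
apply: (H e) => //; apply: (coz_test_cover hu (leIr _ _)) => rho r0.
set a := T [set t | rho <= `|U t|]%classic.
suff ca : continuous_on T a (fun t => V t / U t).
  apply: (ca e e0) => [|c]; first exact: leIr.
  by apply: le_trans (hc c); meets.
apply: (continuous_comp hT (h := fun a b => b / a) (D := fun a _ => rho <= `|a|)).
- by move=> N e1 e10; apply: div_close.
- exact: represents_continuous hu.
- exact: represents_continuous hv.
- exact: lexx.
Qed.

(** The pointfree form of a fact on C(X): if [|v| <= |z| |u|] and [z] vanishes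
    where [u] does, then [u] divides [v].  The quotient [v / u] is bounded by
    [|z|], which makes it continuous at the zeros of [u].  In [V t / U t] the
    convention [x / 0 = 0] gives the right value at those zeros. *)
Lemma division U V Z u v z :
  represents T U u -> represents T V v -> represents T Z z ->
  (forall t, `|V t| <= `|Z t| * `|U t|) -> coz z <= coz u ->
  exists2 k, k * u = v & coz k <= coz z.
Proof.
move=> hu hv hz VZU zu.
have VUZ t : `|V t / U t| <= `|Z t|.
  have [U0|U0] := eqVneq (U t) 0; first by rewrite U0 invr0 mulr0 normr0.
  by rewrite normrM normfV ler_pdivrMr ?normr_gt0.
have [|k hk] := quotient_exists hu hv.
  move=> e x y e0 H1 H2; apply: (coz_small (k := z) (half_pos e0)).
    by apply: le_trans H1; rewrite leI2.
  apply: le_trans H2; rewrite leI2 //.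
  apply: le_trans (rval_test _ _ hz (half_pos e0)) _; apply: (test_le hT) => w /= hw.
  rewrite /fibre /= subr0; apply: le_lt_trans (VUZ w) _; rewrite ltr_norml.
  by move: hw; rewrite -opprD -splitr.
exists k.
  apply: (represents_eq (representsM hk hu) hv) => t.
  have [U0|U0] := eqVneq (U t) 0; last by rewrite divfK.
  by have := VZU t; rewrite U0 normr0 !mulr0 normr_le0 => /eqP.
apply: (coz_represents_le hk hz) => rho r0; exists rho => // t.
by move/le_trans; apply.
Qed.

End Construction.

(** * Roots, inverses, splittings and comparison of functions *)

Section Functions.
Context d (L : frameType d).
Implicit Types (f g h k m : RL L) (x y : L).

(** The composite of [f] with the cube root.  It is described by its values,
    since the cube root does not map rationals to rationals. *)
Definition root_val f (p q : rat) : L := rval f (p * p * p) (q * q * q).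

Lemma root_relations f : real_relations (root_val f).
Proof.
rewrite /root_val; split.
- by move=> p q r s; rewrite rvalI cube_max cube_min.
- move=> p q r s pr rq qs.
  apply: (rel_join (frame_hom_relations f));
    by [exact: cube_le | exact: cube_lt].
- move=> p q; apply/le_anti/andP; split; last first.
    apply: fsup_le => _ [r [s [pr rs sq ->]]].
    by apply: rval_le; apply: cube_le; apply: ltW.
  rewrite -[leLHS]meet1x; apply: rval_inner => r s pr rs sq; rewrite meet1x.
  have [r' pr' r'r] := cube_right pr; have [s' s'q ss'] := cube_left sq.
  apply: (@le_trans _ _ (root_val f r' s')); first by apply: rval_le; apply: ltW.
  apply: fsup_ub; exists r', s'; split=> //.
  rewrite ltNge; apply/negP => /cube_le; clear -r'r rs ss'.
  move: (r' * r' * r') (s' * s' * s') r'r ss' => a b; lra.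
- apply/le_anti; rewrite lex1 andbT; apply: (rval_bounded (phi := f)) => N N0.
  rewrite meet1x; apply: (@le_trans _ _ (root_val f (- (N + 1)) (N + 1))).
    have N3 : N <= (N + 1) * (N + 1) * (N + 1).
      by have N2 := mulr_gt0 N0 N0; have := mulr_gt0 N2 N0; lra.
    by apply: rval_le => //; rewrite mulrNN mulrN lerN2.
  by apply: fsup_ub; exists (- (N + 1)), (N + 1).
Qed.

(** The root [g] is given by [root_val f]; conversely [f] is represented by the
    map [x^3] over [g], as is [g * g * g]. *)
Lemma cube_root f : exists g, f = g * g * g.
Proof.
pose g : RL L := reals_hom (root_relations f); exists g.
have hT := box_testP g g g; have hg := represents1 g g g.
apply: (represents_eq hT _ (representsM hT (representsM hT hg hg) hg) (fun=> erefl)).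
move=> e e0 x y H; apply: (hg 1) => // c.
have [e' e'0 he'] := cube_close (`|c| + 1 + 1 + 1) e0.
pose e2 := Num.min e' 1.
have e20 : 0 < e2 by rewrite lt_min e'0.
have e2e' : e2 <= e' by rewrite ge_min lexx.
have e21 : e2 <= 1 by rewrite ge_min lexx orbT.
apply: (hg e2) => // c'.
set n := near g c' e2; set t := box_test _ _ _ _; set t' := box_test _ _ _ _.
apply: (@le_trans _ _ ((x `&` n) `&` (t `&` t'))); first by meets.
rewrite -(test_setI hT); apply: (test_point hT) => w [/= w1 w2].
have bound v : `|v - c'| <= e2 -> `|v| <= `|c| + 1 + 1 + 1.
  move: w1 w2; rewrite /fibre /= => /norm_near; rewrite distrC => wc w2 vc.
  have := norm_near (lt_le_trans w2 e21); have := ler_normD (v - c') c'.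
  rewrite subrK; move: `|v| `|v - _| `|c'| `|c| wc vc; clear -e21.
  by move: `|_| => ? ? ? ? ? ? ?; lra.
have cc : `|c' - c'| <= e2 by rewrite subrr normr0 ltW.
have close v : `|v - c'| <= e2 -> `|v * v * v - c' * c' * c'| < e.
  by move=> vc; apply: he'; [exact: bound | exact: bound | exact: le_trans e2e'].
have /close c1 : `|c' - e2 - c'| <= e2.
  by rewrite addrAC subrr sub0r normrN gtr0_norm.
have /close c2 : `|c' + e2 - c'| <= e2.
  by rewrite addrAC subrr add0r gtr0_norm.
apply: le_trans (H (c' * c' * c')).
suff nf : n <= near f (c' * c' * c') e.
  rewrite !lexI; apply/and3P; split; [by meets | | by meets].
  apply: leIxr; apply: (test_le hT) => q [_ /= q2]; apply: close; exact: ltW.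
move: c1 c2; rewrite !ltr_distl => /andP[/ltW c1 _] /andP[_ /ltW c2].
by rewrite /n /near [leLHS]rval_ext; apply: rval_le.
Qed.

(** The inverse is obtained as the quotient of [f] by [f^2]. *)
Lemma coz_unit f : coz f = \top -> exists g, f * g = 1.
Proof.
move=> f1; have hT := box_testP f f f; have hf := represents1 f f f.
have ff1 : coz (f * f) = \top by rewrite cozM f1 meetxx.
have [|g hg] := quotient_exists hT (representsM hT hf hf) hf.
  by move=> e x y e0; rewrite ff1 meetx1.
exists g; apply/eqP; rewrite -subr_eq0; apply/eqP/coz_eq0.
rewrite -(meet1x (coz _)) -f1 -cozM mulrBr mulr1 mulrA.
have -> : f * f * g = f.
  apply: (represents_eq hT (representsM hT (representsM hT hf hf) hg) hf) => t /=.
  have [->|t0] := eqVneq t.1.1 0; first by rewrite !mul0r.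
  by rewrite mulrC divfK // mulf_neq0.
by rewrite subrr coz0.
Qed.

Lemma coz_sum_squares f g : coz f `|` coz g <= coz (f * f + g * g).
Proof.
have hT := box_testP f g f.
have hf := represents1 f g f; have hg := represents2 f g f.
have hs := representsD hT (representsM hT hf hf) (representsM hT hg hg).
by rewrite leUx; apply/andP; split;
  [apply: (coz_represents_le hT hf hs) | apply: (coz_represents_le hT hg hs)];
  move=> rho r0; exists (rho * rho) => [|t ht]; rewrite ?mulr_gt0 //;
  apply: le_trans (ler_norm _); move: ht; rewrite ler_normr => /orP[ht|ht]; nra.
Qed.

(** On [coz f v coz g] the function [h] decomposes as
    [f^2 h / (f^2 + g^2) + g^2 h / (f^2 + g^2)]; both quotients are bounded by
    [|h|]. *)
Lemma splitting f g h : f * g = 0 -> coz h <= coz f `|` coz g ->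
  exists h1 h2, [/\ h = h1 + h2, coz h1 <= coz f & coz h2 <= coz g].
Proof.
move=> fg hfg; pose s := f * f + g * g.
have hs : coz h <= coz s := le_trans hfg (coz_sum_squares f g).
have part a b : a * a + b * b = s -> exists2 k, k * s = a * a * h & coz k <= coz a.
  move=> ab; have hT := box_testP a b h.
  have ra := represents1 a b h; have rb := represents2 a b h; have rh := represents3 a b h.
  have raa := representsM hT ra ra; have rbb := representsM hT rb rb.
  rewrite -ab in hs *.
  have [t|//|k ks kh] := division hT (representsD hT raa rbb) (representsM hT raa rh) rh.
    rewrite normrM mulrC; apply: ler_wpM2l => //.
    by rewrite !ger0_norm ?addr_ge0 -?expr2 ?sqr_ge0 // lerDl sqr_ge0.
  exists k => //; have : coz k `&` coz (a * a + b * b) <= coz a.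
    by rewrite -cozM ks !cozM; meets.
  by rewrite (meet_l (le_trans kh hs)).
have [h1 e1 c1] := part f g erefl.
have [h2 e2 c2] := part g f (addrC _ _).
exists h1, h2; split=> //; apply/eqP; rewrite -subr_eq0; apply/eqP/coz_eq0.
have : coz (h - (h1 + h2)) <= coz s.
  rewrite -mulN1r; apply: le_trans (cozD _ _) _; rewrite leUx hs cozM leIxr //.
  apply: le_trans (cozD _ _) (le_trans _ (coz_sum_squares f g)).
  by rewrite leU2.
move/meet_idPl <-; rewrite -cozM mulrBl mulrDl e1 e2 -mulrDl mulrC subrr.
exact: coz0.
Qed.

(** [P] and [N] are the positive and the negative part of [f^2 - g^2], so that
    [f^2 + N = g^2 + P] is the maximum of [f^2] and [g^2].  The maximum divides
    [f^2 m] and [g^2 m] for [m = f^2 + g^2], since the quotients are bounded by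
    [|m|]. *)
Lemma comparison f g : exists P N k l, [/\ P * N = 0, f * f + N = g * g + P,
  k * (f * f + N) = f * f * (f * f + g * g) &
  l * (f * f + N) = g * g * (f * f + g * g)].
Proof.
have hT := box_testP f g 0; set T := box_test f g 0 in hT.
have rf : represents T (fun t => t.1.1) f := represents1 f g 0.
have rg : represents T (fun t => t.1.2) g := represents2 f g 0.
have rff := representsM hT rf rf; have rgg := representsM hT rg rg.
have rs := representsD hT rff rgg.
have pos F G a b : represents T F a -> represents T G b ->
    exists P, represents T (fun t => Num.max 0 (F t - G t)) P.
  move=> ra rb; apply: (represents_exists hT).
  apply: (continuous_comp hT (h := fun u v => Num.max 0 (u - v)) (D := fun _ _ => True)).
  - by move=> N e; apply: posdiff_close.
  - exact: represents_continuous ra.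
  - exact: represents_continuous rb.
  - apply: le_trans (lex1 _) _; rewrite -(test_setT hT); exact: (test_le hT).
have [P rP] := pos _ _ _ _ rff rgg; have [N rN] := pos _ _ _ _ rgg rff.
have rM := representsD hT rff rN.
have maxE (a b : rat) : a + Num.max 0 (b - a) = Num.max a b.
  by case: (leP 0 (b - a)); case: (leP a b); lra.
have sq0 (x : rat) : 0 <= x * x by rewrite -expr2 sqr_ge0.
have sM : coz (f * f + g * g) <= coz (f * f + N).
  apply: (coz_represents_le hT rs rM) => rho r0; exists (rho / 2) => [|t].
    exact: half_pos.
  rewrite maxE ger0_norm ?addr_ge0 // => h; apply: le_trans (ler_norm _).
  by rewrite le_max; case: (leP (t.1.1 * t.1.1) (t.1.2 * t.1.2)) => h'; apply/orP;
    [right | left]; lra.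
have bound (a b c : rat) : 0 <= a -> a <= b -> `|a * c| <= `|c| * `|b|.
  by move=> a0 ab; rewrite normrM mulrC ler_wpM2l // !ger0_norm //; apply: le_trans ab.
have [t|//|k kM _] := division hT rM (representsM hT rff rs) rs.
  by apply: bound => //; rewrite maxE le_max lexx.
have [t|//|l lM _] := division hT rM (representsM hT rgg rs) rs.
  by apply: bound => //; rewrite maxE le_max lexx orbT.
exists P, N, k, l; split=> //.
  apply: (represents_eq hT (representsM hT rP rN) (represents0 hT)) => t.
  move: (t.1.1 * t.1.1) (t.1.2 * t.1.2) => a b.
  by have [ab|/ltW ba] := leP a b;
    [rewrite (max_idPl _) ?subr_le0 // mul0r | rewrite mulrC (max_idPl _) ?subr_le0 // mul0r].
apply: (represents_eq hT rM (representsD hT rgg rP)) => t.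
by rewrite !maxE maxC.
Qed.

End Functions.

(** * Regular functions and complemented cozero elements *)

(** Von Neumann regularity. *)
Definition regular (R : comPzRingType) (f : R) : Prop := exists t, f = f * f * t.

Section Regular.
Context d (L : frameType d).
Implicit Types (f g h k m e : RL L) (a b x y : L).

(** The function with value 0 on [a] and value 1 on [b]. *)
Definition indicator_val a b (p q : rat) : L :=
  (cst_val L 0 p q `&` a) `|` (cst_val L 1 p q `&` b).

Lemma indicator_relations a b : a `&` b = \bot -> a `|` b = \top ->
  real_relations (indicator_val a b).
Proof.
move=> ab0 ab1; have h0 := cst_relations L 0; have h1 := cst_relations L 1.
rewrite /indicator_val; split.
- move=> p q r s; rewrite frame_meetUl !frame_meetUr.
  rewrite !(meetACA _ a) !(meetACA _ b) !meetxx ab0 (meetC b) ab0 !meetx0.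
  by rewrite joinx0 join0x (rel_meet h0) (rel_meet h1).
- move=> p q r s pr rq qs; rewrite joinACA -!frame_meetUl.
  by rewrite (rel_join h0) // (rel_join h1).
- move=> p q; apply/le_anti/andP; split; last first.
    apply: fsup_le => _ [r [s [pr rs sq ->]]].
    by apply: leU2; apply: leI2 => //; [apply: (rel_le h0)|apply: (rel_le h1)]; apply: ltW.
  rewrite leUx; apply/andP; split; rewrite meetC.
    rewrite (rel_sup h0); apply: meet_fsup_le => _ [r [s [pr rs sq ->]]].
    apply: (@le_trans _ _ (indicator_val a b r s)).
      by rewrite meetC /indicator_val lexUl.
    by apply: fsup_ub; exists r, s.
  rewrite (rel_sup h1); apply: meet_fsup_le => _ [r [s [pr rs sq ->]]].
  apply: (@le_trans _ _ (indicator_val a b r s)).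
    by rewrite meetC /indicator_val lexUr.
  by apply: fsup_ub; exists r, s.
- apply/le_anti; rewrite lex1 andbT; apply: (@le_trans _ _ (indicator_val a b (-1) 2)).
    by rewrite /indicator_val !cst_val_in // !meet1x ab1.
  by apply: fsup_ub; exists (-1), 2.
Qed.

Lemma indicator_exists a b : a `&` b = \bot -> a `|` b = \top ->
  exists e : RL L, coz e = b.
Proof.
move=> ab0 ab1; exists (reals_hom (indicator_relations ab0 ab1)).
apply/le_anti/andP; split.
  apply: (coz_cover (lexx _)) => p q pq; apply: leIxr.
  rewrite [leLHS]rval_ext /indicator_val cst_val_out ?meet0x ?join0x ?leIr //.
  by lra.
apply: (@le_trans _ _ (rval (reals_hom (indicator_relations ab0 ab1) : RL L) 0 2)).
  rewrite [leRHS]rval_ext /indicator_val [cst_val L 1 0 2]cst_val_in // meet1x.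
  exact: leUr.
exact: rval_coz_pos.
Qed.

Lemma disjoint_pcomplement a : a `&` pcomplement a = \bot.
Proof.
apply/le_anti; rewrite le0x andbT; apply: meet_fsup_le => x /= xa.
by rewrite meetC xa.
Qed.

Lemma coz_idempotentC e : e * e = e ->
  coz e `&` coz (1 - e) = \bot /\ coz e `|` coz (1 - e) = \top.
Proof.
move=> ee; split; first by rewrite -cozM mulrBr mulr1 ee subrr coz0.
apply/le_anti; rewrite lex1 /= -(coz1 L); apply: le_trans (cozD _ _).
by rewrite addrC subrK.
Qed.

Lemma complemented_of_complement a : (exists2 b, a `&` b = \bot & a `|` b = \top) ->
  complemented a.
Proof.
move=> [b ab0 ab1]; apply/le_anti; rewrite lex1 -ab1 /= leU2 //.
by apply: fsup_ub; rewrite /= meetC.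
Qed.

(** [f t] is idempotent with the same cozero element as [f], and [1 - f t] has the
    complementary one. *)
Lemma regular_complemented f : regular f -> complemented (coz f).
Proof.
move=> [t ft]; have ee : f * t * (f * t) = f * t.
  by rewrite [in RHS]ft; ring.
have [h0 h1] := coz_idempotentC ee.
have fe : coz f = coz (f * t).
  by apply/le_anti; rewrite {1}ft -mulrA mulrCA !cozM !leIr leIl.
by apply: complemented_of_complement; exists (coz (1 - f * t)); rewrite fe.
Qed.

(** Adding to [f] the characteristic function [g] of the complement gives a unit
    [f + g], and [f (f + g) = f^2]. *)
Lemma complemented_regular f : complemented (coz f) -> regular f.
Proof.
move=> cf; have [g gf] := indicator_exists (disjoint_pcomplement _) cf.
have fg : f * g = 0 by apply: coz_eq0; rewrite cozM gf disjoint_pcomplement.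
have [] := @coz_unit _ _ (f + g).
  apply/le_anti; rewrite lex1 /= -cf -gf leUx.
  have le k : coz k = coz (k * (f + g)) -> coz k <= coz (f + g).
    by move=> ->; rewrite cozM leIr.
  rewrite !le // mulrDr; first by rewrite (mulrC g) fg add0r cozM meetxx.
  by rewrite fg addr0 cozM meetxx.
move=> t ht; exists t; rewrite -[LHS]mulr1 -ht; ring: fg.
Qed.

End Regular.

(** * Comparison of functions on a P_F-frame *)

(** A cosmall idempotent stands for a clopen neighbourhood of the place where
    regularity fails. *)
Definition cosmall (R : comPzRingType) (e : R) : Prop :=
  e * e = e /\ forall f, regular (f * (1 - e)).

Section Ideals.
Context d (L : frameType d).
Implicit Types (f g h k e phi : RL L) (I J : set (RL L)).

(** Two cozero elements are disjoint iff the functions have product 0. *)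
Lemma PF_frameP :
  PF_frame L <-> forall f g : RL L, f * g = 0 -> regular f \/ regular g.
Proof.
split=> [PF f g fg|H _ _ [f _ <-] [g _ <-] fg].
  have [|||cf|cg] := PF (coz f) (coz g).
  - by exists f.
  - by exists g.
  - by rewrite -cozM fg coz0.
  - by left; apply: complemented_regular.
  - by right; apply: complemented_regular.
have [||] := H f g; first by apply: coz_eq0; rewrite cozM.
  by left; apply: regular_complemented.
by right; apply: regular_complemented.
Qed.

Lemma coz_exp f n : coz (f ^+ n.+1) = coz f.
Proof. by elim: n => [|n IHn]; rewrite ?expr1 // exprS cozM IHn meetxx. Qed.

(** With the idempotent [e = f t], the element [phi e + (1 - e)] is a unit; its
    product with [e] is [phi e], so [e], and with it [f], is a multiple of [phi]. *)
Lemma regular_mem I phi f : is_ideal I -> I phi -> coz f <= coz phi ->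
  regular f -> I f.
Proof.
move=> [_ _ IM] Iphi fphi [t ft]; pose e := f * t.
have fe : f * e = f by rewrite /e [in RHS]ft; ring.
have ee : e * e = e by rewrite /e [in RHS]ft; ring.
have [h0 h1] := coz_idempotentC ee.
pose u := phi * e + (1 - e).
have ue : e * u = phi * e by rewrite /u mulrDr mulrCA ee mulrBr mulr1 ee subrr addr0.
have [|w uw] := @coz_unit _ _ u.
  apply/le_anti; rewrite lex1 /= -h1 leUx; apply/andP; split.
    have <- : coz (e * u) = coz e.
      rewrite ue cozM; apply: meet_r; apply: le_trans fphi.
      by rewrite cozM leIl.
    by rewrite cozM leIr.
  have <- : coz ((1 - e) * u) = coz (1 - e).
    have -> : (1 - e) * u = (1 - e) * (1 - e).
      by rewrite /u; ring: ee.
    by rewrite cozM meetxx.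
  by rewrite cozM leIr.
have -> : f = f * e * w * phi.
  by rewrite -[LHS]fe -[LHS]mulr1 -uw; ring: ue.
exact: IM.
Qed.

(** Membership in an ideal may be tested on a cosmall idempotent: the remaining
    part [f (1 - e)] is regular and is handled by [regular_mem]. *)
Lemma cosmall_mem I phi f e : is_ideal I -> I phi -> coz f <= coz phi ->
  cosmall e -> I (f * e) -> I f.
Proof.
move=> hI Iphi fphi [_ he] Ife; have [_ ID _] := hI.
have -> : f = f * e + f * (1 - e) by ring.
apply: ID => //; apply: (regular_mem hI Iphi) => //.
by apply: le_trans fphi; rewrite cozM leIl.
Qed.

Section PF.
Context (PF : forall f g : RL L, f * g = 0 -> regular f \/ regular g).

(** Nonregular multiples [f (1 - e)] of [1 - e] and [g e] of [e] would have
    product 0. *)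
Lemma cosmall_or e : e * e = e -> cosmall e \/ cosmall (1 - e).
Proof.
move=> ee; have [|ne] := pselect (cosmall e); first by left.
right; split; first by ring: ee.
move=> g; have [f nf] : exists f, ~ regular (f * (1 - e)).
  by apply: contrapT => h; apply: ne; split=> // f; apply: contrapT => nf; apply: h; exists f.
have [||] := @PF (f * (1 - e)) (g * (1 - (1 - e))) => //.
by ring: ee.
Qed.

(** If [P] of [comparison] is regular, then [P = P^2 t] vanishes on the idempotent
    [1 - P t], and [N] vanishes on [P t].  On the former [g^2] is the maximum of
    [f^2] and [g^2], on the latter [f^2] is, and one of the two is cosmall. *)
Lemma comparable_powers f g : exists2 e, cosmall e &
  (exists k, f ^+ 4 * e = k * g ^+ 2) \/ (exists k, g ^+ 4 * e = k * f ^+ 2).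
Proof.
have aux a b P N k l : P * N = 0 -> a * a + N = b * b + P ->
   k * (a * a + N) = a * a * (a * a + b * b) ->
   l * (a * a + N) = b * b * (a * a + b * b) -> regular P ->
   exists2 e, cosmall e & (exists k, a ^+ 4 * e = k * b ^+ 2) \/
                          (exists k, b ^+ 4 * e = k * a ^+ 2).
  move=> PN abPN ka lb [t Pt]; pose e := 1 - P * t.
  have Pe : P * e = 0 by rewrite /e mulrBr mulr1 mulrA -Pt subrr.
  have ee : e * e = e by rewrite {1}/e mulrBl mul1r mulrAC Pe mul0r subr0.
  have [he|he] := cosmall_or ee.
    exists e => //; left; exists (k * e - a ^+ 2 * e).
    have : k * (b * b + P) * e = a * a * (a * a + b * b) * e by rewrite -abPN ka.
    have -> : a ^+ 4 * e = a * a * (a * a + b * b) * e - a * a * (b * b) * e by ring.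
    by move=> <-; ring: Pe.
  exists (1 - e) => //; right; exists (l * (1 - e) - b ^+ 2 * (1 - e)).
  have Ne : N * (1 - e) = 0 by rewrite /e; ring: PN.
  have : l * (a * a + N) * (1 - e) = b * b * (a * a + b * b) * (1 - e) by rewrite lb.
  have -> : b ^+ 4 * (1 - e)
    = b * b * (a * a + b * b) * (1 - e) - b * b * (a * a) * (1 - e) by ring.
  have -> : l * (a * a + N) * (1 - e) = l * (a * a) * (1 - e) + l * (N * (1 - e)).
    by ring.
  by move=> <-; rewrite Ne; ring.
have [P [N [k [l [PN fg kf lg]]]]] := comparison f g.
have [rP|rN] := PF PN; first exact: aux PN fg kf lg rP.
have NP : N * P = 0 by rewrite mulrC.
have lg' : l * (g * g + P) = g * g * (g * g + f * f) by rewrite -fg lg addrC.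
have kf' : k * (g * g + P) = f * f * (g * g + f * f) by rewrite -fg kf addrC.
have [e he [h|h]] := aux g f N P l k NP (esym fg) lg' kf' rN.
  by exists e => //; right.
by exists e => //; left.
Qed.

End PF.

(** Here [f] is the 27th root, obtained as three iterated cube roots, of a function
    that violates the z-ideal property.  The exponent leaves room for the powers
    lost in [comparable_powers]. *)
Lemma not_z_ideal I : is_ideal I -> ~ z_ideal I ->
  exists f phi, [/\ I phi, coz f = coz phi & ~ I (f ^+ 27)].
Proof.
move=> hI nz; apply: contrapT => H; apply: nz; split=> // a phi Iphi aphi.
apply: contrapT => na; apply: H.
have [f1 e1] := cube_root a; have [f2 e2] := cube_root f1; have [f e3] := cube_root f2.
have af : a = f ^+ 27 by rewrite e1 e2 e3; ring.
by exists f, phi; rewrite -(coz_exp f 26) -af.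
Qed.

End Ideals.

(** * Ideals on a P_F-frame *)

Section Forward.
Context d (L : frameType d).
Implicit Types (f g h k e phi : RL L) (I J : set (RL L)).
Context (PF : forall f g : RL L, f * g = 0 -> regular f \/ regular g).

(** Let [f = i + j].  If [j^4 e] is a multiple of [i^2], then every term of the
    expansion of [(i + j)^4 e] lies in [I], and symmetrically. *)
Lemma cosmall_sum I J f : is_ideal I -> is_ideal J -> ideal_sum I J f ->
  exists2 e, cosmall e & I (f ^+ 4 * e) \/ J (f ^+ 4 * e).
Proof.
move=> [_ ID IM] [_ JD JM] [i Ii [j Jj <-]].
have [e he [[k hk]|[k hk]]] := comparable_powers PF i j; exists e => //.
  right; have -> : (i + j) ^+ 4 * e
    = k * j * j + (4 * i ^+ 3 + 6 * i ^+ 2 * j + 4 * i * j ^+ 2 + j ^+ 3) * e * j.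
    rewrite -mulrA -expr2 -hk; ring.
  by apply: JD; apply: JM.
left; have -> : (i + j) ^+ 4 * e
  = k * i * i + (4 * j ^+ 3 + 6 * j ^+ 2 * i + 4 * j * i ^+ 2 + i ^+ 3) * e * i.
  rewrite -mulrA -expr2 -hk; ring.
by apply: ID; apply: IM.
Qed.

Lemma mem_exp I f m n : is_ideal I -> (m <= n)%N -> I (f ^+ m) -> I (f ^+ n).
Proof. by move=> [_ _ IM] mn If; rewrite -(subnK mn) exprD; apply: IM. Qed.

(** Let [f] and [g] be deep roots of witnesses against [I] and [J].  They belong to
    the sum, hence [f^4] lies in [J] and [g^4] in [I] on cosmall idempotents, as
    the other possibility would put a power of [f] in [I] or of [g] in [J].  But
    [f^4] and [g^4] are comparable: if [f^16 e] is a multiple of [g^8], then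
    [f^16] lies in [I], and in the other case [g^16] lies in [J]. *)
Lemma z_ideal_of_sum I J : is_ideal I -> is_ideal J ->
  z_ideal (ideal_sum I J) -> z_ideal I \/ z_ideal J.
Proof.
move=> hI hJ [_ zIJ]; apply: contrapT => /not_orP[nI nJ].
have [f [phi [Iphi fphi nIf]]] := not_z_ideal hI nI.
have [g [psi [Jpsi gpsi nJg]]] := not_z_ideal hJ nJ.
have [[I0 _ IM] [J0 _ JM]] := (hI, hJ).
have nIf' n e : (0 < n <= 27)%N -> cosmall e -> ~ I (f ^+ n * e).
  case: n => // n /= n27 he If; apply: nIf; apply: (mem_exp hI n27).
  by apply: (cosmall_mem hI Iphi _ he If); rewrite coz_exp fphi.
have nJg' n e : (0 < n <= 27)%N -> cosmall e -> ~ J (g ^+ n * e).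
  case: n => // n /= n27 he Jg; apply: nJg; apply: (mem_exp hJ n27).
  by apply: (cosmall_mem hJ Jpsi _ he Jg); rewrite coz_exp gpsi.
have IJf : ideal_sum I J f.
  by apply: zIJ fphi; exists phi => //; exists 0; rewrite ?addr0.
have IJg : ideal_sum I J g.
  by apply: zIJ gpsi; exists 0 => //; exists psi; rewrite ?add0r.
have [e1 he1 [/(nIf' 4%N _ isT he1) //|Jf]] := cosmall_sum hI hJ IJf.
have [e2 he2 [Ig|/(nJg' 4%N _ isT he2) //]] := cosmall_sum hI hJ IJg.
have [e he [[k hk]|[k hk]]] := comparable_powers PF (f ^+ 4) (g ^+ 4).
  apply: (nIf' 16%N e) => //; apply: (cosmall_mem hI Iphi _ he2).
    by rewrite -fphi cozM (coz_exp f 15) leIl.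
  have -> : f ^+ 16 * e * e2 = k * g ^+ 4 * (g ^+ 4 * e2).
    by rewrite (exprM f 4 4) hk; ring.
  exact: IM.
apply: (nJg' 16%N e) => //; apply: (cosmall_mem hJ Jpsi _ he1).
  by rewrite -gpsi cozM (coz_exp g 15) leIl.
have -> : g ^+ 16 * e * e1 = k * f ^+ 4 * (f ^+ 4 * e1).
  by rewrite (exprM g 4 4) hk; ring.
exact: JM.
Qed.

(** For [f] and [g] as for the sum, [f g] lies in the intersection because
    [coz (f g) = coz (phi psi)].  If [f^4 e] is a multiple of [g^2], then [f^5 e]
    is a multiple of [f g], hence [f^5] lies in [I]; and symmetrically. *)
Lemma z_ideal_of_cap I J : is_ideal I -> is_ideal J ->
  z_ideal (I `&` J)%classic -> z_ideal I \/ z_ideal J.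
Proof.
move=> hI hJ [_ zIJ]; apply: contrapT => /not_orP[nI nJ].
have [f [phi [Iphi fphi nIf]]] := not_z_ideal hI nI.
have [g [psi [Jpsi gpsi nJg]]] := not_z_ideal hJ nJ.
have [[I0 _ IM] [J0 _ JM]] := (hI, hJ).
have [Ifg Jfg] : (I `&` J)%classic (f * g).
  apply: (zIJ _ (phi * psi)); last by rewrite !cozM fphi gpsi.
  by split; [rewrite mulrC; apply: IM | apply: JM].
have [e he [[k hk]|[k hk]]] := comparable_powers PF f g.
  apply: nIf; apply: (mem_exp (m := 5) hI) => //.
  apply: (cosmall_mem hI Iphi _ he); first by rewrite (coz_exp f 4) fphi.
  have -> : f ^+ 5 * e = k * g * (f * g) by rewrite exprS -mulrA hk; ring.
  exact: IM.
apply: nJg; apply: (mem_exp (m := 5) hJ) => //.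
apply: (cosmall_mem hJ Jpsi _ he); first by rewrite (coz_exp g 4) gpsi.
have -> : g ^+ 5 * e = k * f * (f * g) by rewrite exprS -mulrA hk; ring.
exact: JM.
Qed.

End Forward.

(** * Ideals that detect complemented cozero elements *)

Section Backward.
Context d (L : frameType d).
Implicit Types (f g h k e phi : RL L) (I J : set (RL L)).

Definition supported_in f : set (RL L) := [set h | coz h <= coz f]%classic.

Lemma supported_ideal f : is_ideal (supported_in f).
Proof.
rewrite /supported_in /mkset; split=> [|a b|a b]; first by rewrite coz0 le0x.
  by move=> af bf; apply: le_trans (cozD _ _) _; rewrite leUx af.
by move=> bf; rewrite cozM leIxr.
Qed.

Definition principal (R : comPzRingType) (f : R) : set R :=
  [set k * f | k in setT]%classic.

Lemma principal_ideal (R : comPzRingType) (f : R) : is_ideal (principal f).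
Proof.
split=> [|_ _ [a _ <-] [b _ <-]|a _ [b _ <-]].
- by exists 0; rewrite // mul0r.
- by exists (a + b); rewrite // mulrDl.
- by exists (a * b); rewrite // mulrA.
Qed.

Lemma ideal_sum_ideal (R : comPzRingType) (I J : set R) :
  is_ideal I -> is_ideal J -> is_ideal (ideal_sum I J).
Proof.
move=> [I0 ID IM] [J0 JD JM]; split.
- by exists 0 => //; exists 0; rewrite // addr0.
- move=> _ _ [a Ia [b Jb <-]] [a' Ia' [b' Jb' <-]].
  exists (a + a'); first exact: ID.
  by exists (b + b'); [exact: JD | rewrite addrACA].
- move=> c _ [a Ia [b Jb <-]]; exists (c * a); first exact: IM.
  by exists (c * b); [exact: JM | rewrite mulrDr].
Qed.

(** The ideal contains the cube root [r] of [f], say [r = k f + t] with [r t = 0];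
    then [r^2 = r^4 k], so [r^2] is regular, and [coz (r^2) = coz f]. *)
Lemma complemented_of_z_ideal f g : f * g = 0 ->
  z_ideal (ideal_sum (principal f) (supported_in g)) -> complemented (coz f).
Proof.
move=> fg [_ zI]; have [r fr] := cube_root f.
have rf : coz r = coz f by rewrite fr !cozM !meetxx.
have [_ [k _ <-] [t /= tg rt]] :
    ideal_sum (principal f) (supported_in g) r.
  apply: (zI _ f) => //; exists f; first by exists 1; rewrite // mul1r.
  by exists 0; rewrite ?addr0 // /supported_in /mkset coz0 le0x.
rewrite -rf -(meetxx (coz r)) -cozM.
have tr : r * t = 0.
  apply: coz_eq0; apply/le_anti; rewrite le0x andbT -(coz0 L) -fg !cozM rf.
  exact: leI2.
apply: regular_complemented; exists k.
by rewrite -{2}rt mulrDr tr addr0 fr; ring.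
Qed.

(** The sum of the two ideals is [{h | coz h <= coz f v coz g}], a z-ideal by its
    form and proper because otherwise [coz g] would be a complement of [coz f]. *)
Lemma PF_of_sum :
  (forall I J : set (RL L), is_ideal I -> is_ideal J ->
      ideal_sum I J <> setT -> z_ideal (ideal_sum I J) ->
      z_ideal I \/ z_ideal J) -> PF_frame L.
Proof.
move=> H _ _ [f _ <-] [g _ <-] fg0; apply: contrapT => /not_orP[nf ng].
have fg : f * g = 0 by apply: coz_eq0; rewrite cozM.
pose I := ideal_sum (principal f) (supported_in g).
pose J := ideal_sum (principal g) (supported_in f).
have hI : is_ideal I.
  by apply: ideal_sum_ideal; [exact: principal_ideal | exact: supported_ideal].
have hJ : is_ideal J.
  by apply: ideal_sum_ideal; [exact: principal_ideal | exact: supported_ideal].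
have IJle h : ideal_sum I J h -> coz h <= coz f `|` coz g.
  move=> [_ [_ [a _ <-] [b bg <-]] [_ [_ [a' _ <-] [b' b'f <-]] <-]].
  have le1 c c' e e' : coz c' <= coz e' -> coz (c * e + c') <= coz e `|` coz e'.
    by move=> ce; apply: le_trans (cozD _ _) _; rewrite leU2 // cozM leIr.
  apply: le_trans (cozD _ _) _; rewrite leUx le1 //= joinC; exact: le1.
have leIJ h : coz h <= coz f `|` coz g -> ideal_sum I J h.
  move=> /(splitting fg)[h1 [h2 [-> h1f h2g]]]; rewrite addrC.
  exists h2; first by exists 0; [exists 0; rewrite // mul0r | exists h2; rewrite // add0r].
  exists h1 => //; exists 0; first by exists 0; rewrite // mul0r.
  by exists h1; rewrite // add0r.
have [||zI|zJ] := H I J hI hJ.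
- move=> IJT; apply: nf; apply: complemented_of_complement; exists (coz g) => //.
  apply/le_anti; rewrite lex1 /= -(coz1 L); apply: IJle.
  by rewrite IJT.
- split; first exact: ideal_sum_ideal.
  by move=> a phi /IJle hphi aphi; apply: leIJ; rewrite aphi.
- exact: nf (complemented_of_z_ideal fg zI).
- by apply: ng; apply: complemented_of_z_ideal zJ; rewrite mulrC.
Qed.

(** The principal ideals of [f] and [g] intersect in 0 if [f g = 0].  That a
    principal ideal is a z-ideal only if its generator is regular is the case
    [g = 0] of [complemented_of_z_ideal]. *)
Lemma PF_of_cap :
  (forall I J : set (RL L), is_ideal I -> is_ideal J ->
      z_ideal (I `&` J)%classic -> z_ideal I \/ z_ideal J) -> PF_frame L.
Proof.
have sum0 f : ideal_sum (principal f) (supported_in 0) = principal f.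
  apply/seteqP; split=> [_ [a fa [b /= b0 <-]]|a fa].
    have -> : b = 0 by apply: coz_eq0; apply/le_anti; rewrite le0x -(coz0 L) b0.
    by rewrite addr0.
  by exists a => //; exists 0; [exact: lexx | rewrite addr0].
have compl f : z_ideal (principal f) -> complemented (coz f).
  by rewrite -sum0; apply: complemented_of_z_ideal; rewrite mulr0.
move=> H _ _ [f _ <-] [g _ <-] fg0.
have cap0 h : (principal f `&` principal g)%classic h -> h = 0.
  move=> [[a _ ah] [b _ bh]]; apply: coz_eq0; apply/le_anti; rewrite le0x andbT.
  by rewrite -fg0 lexI -{1}ah -bh !cozM !leIr.
have [[f0 fD fM] [g0 gD gM]] := (principal_ideal f, principal_ideal g).
have zcap : z_ideal (principal f `&` principal g)%classic.
  split.
    split=> [//|a b [fa ga] [fb gb]|a b [fb gb]]; split;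
      by [apply: fD | apply: gD | apply: fM | apply: gM].
  by move=> a phi /cap0 ->; rewrite coz0 => /coz_eq0 ->.
have [zf|zg] := H _ _ (principal_ideal f) (principal_ideal g) zcap.
  by left; apply: compl.
by right; apply: compl.
Qed.

End Backward.

Theorem proposition5p8 (d : Order.disp_t) (L : frameType d)
    (L_completely_regular : completely_regular L) :
  ((forall I J : set (RL L), is_ideal I -> is_ideal J ->
      ideal_sum I J <> setT -> z_ideal (ideal_sum I J) ->
      z_ideal I \/ z_ideal J)
   <-> PF_frame L)
  /\
  (PF_frame L <->
   (forall I J : set (RL L), is_ideal I -> is_ideal J ->
      z_ideal (I `&` J)%classic ->
      z_ideal I \/ z_ideal J)).
Proof.
split; split.
- exact: PF_of_sum.
- by move=> /PF_frameP PF I J hI hJ _; apply: z_ideal_of_sum.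
- by move=> /PF_frameP PF I J hI hJ; apply: z_ideal_of_cap.
- exact: PF_of_cap.
Qed.
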